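(* Let $\mathbb K\in\{\mathbb R,\mathbb C\}$, let $\Omega\subseteq\mathbb C$ be a domain, let $N\ge 1$ and $1\le \ell\le N$ be integers, and let $\mathcal W\subset L^2(\Omega,\mathbb K^N)$ be a subspace. Let $\mathcal A\colon \mathcal W\to L^2(\Omega,\mathbb K^N)$ be a fixed (deterministic) operator that commutes with linear maps, i.e. for all $f\in\mathcal W$ and all $B\in\mathbb K^{N\times N}$ one has $Bf\in\mathcal W$ and $\mathcal A(Bf)=B\,\mathcal A(f)$. Let $f\in\mathcal W$ with $f-\mathcal A(f)\neq 0$, and let $\rho$ denote the stable rank of $f-\mathcal A(f)$. Let $\widetilde V\in\mathbb K^{N\times \ell}$ be a real (for $\mathbb K=\mathbb R$) or complex (for $\mathbb K=\mathbb C$) Gaussian random matrix, and set $V=\widetilde V/\sqrt{c\ell}$ with $c=1$ for $\mathbb K=\mathbb R$ and $c=2$ for $\mathbb K=\mathbb C$. Then for any $\tau>1$ we have $$\mathrm{Prob}\Big(\|f-\mathcal A(f)\|\ge \tau\,\|V^Tf-\mathcal A(V^Tf)\|\Big)\le \frac{1}{\Gamma(c\ell/2)}\,\gamma\big(c\ell/2,\; c\ell\rho\tau^{-2}/2\big),$$ where $\gamma(s,x):=\int_0^x t^{s-1}e^{-t}\,\mathrm dt$ denotes the lower incomplete gamma function, and $$\mathrm{Prob}\Big(\|f-\mathcal A(f)\|\le \tau^{-1}\,\|V^Tf-\mathcal A(V^Tf)\|\Big)\le \exp\Big(-\frac{c\ell}{2}\,\rho(\tau-1)^2\Big).$$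
   Context: Norms. For an integer $m\ge1$ and $h\in L^2(\Omega,\mathbb K^m)$, $\|h\|^2:=\int_\Omega\|h(z)\|_2^2\,\mathrm dz$, where $\|\cdot\|_2$ is the Euclidean norm and $\mathrm dz$ is Lebesgue measure on $\Omega\subseteq\mathbb C\cong\mathbb R^2$. For a matrix $B$, $Bf$ denotes the function $z\mapsto Bf(z)$; likewise $V^Tf$ is $z\mapsto V^Tf(z)$, where $V^T$ is the transpose (not the conjugate transpose). Singular values and stable rank. Every $h\in L^2(\Omega,\mathbb K^N)$ induces the operator $\mathcal L_h\colon L^2(\Omega,\mathbb K)\to\mathbb K^N$, $\mathcal L_h v=\int_\Omega h(z)v(z)\,\mathrm dz$, which has rank at most $N$. There are orthonormal $u_1,\dots,u_N\in\mathbb K^N$, orthonormal $v_1,\dots,v_N\in L^2(\Omega,\mathbb K)$ and uniquely determined singular values $\sigma_1\ge\dots\ge\sigma_N\ge0$ with $h(z)=\sum_{j=1}^N\sigma_ju_jv_j(z)$; in particular $\sigma_1$ is the operator norm of $\mathcal L_h$, and $\|h\|^2=\sigma_1^2+\dots+\sigma_N^2$. The stable rank of $h\ne0$ is $\rho:=\|h\|^2/\sigma_1^2$. Convention for $\mathcal A$ on shorter vectors. For $m<N$ and $\widetilde f\colon\Omega\to\mathbb K^m$ such that the zero-padded function $\binom{\widetilde f}{0}\colon\Omega\to\mathbb K^N$ lies in $\mathcal W$, the commutation property implies that $\mathcal A\binom{\widetilde f}{0}=\binom{\widetilde g}{0}$ for some $\widetilde g\colon\Omega\to\mathbb K^m$,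 and one writes $\mathcal A(\widetilde f):=\widetilde g$. This defines $\mathcal A(V^Tf)$ when $\ell<N$; when $\ell=N$, $\mathcal A$ is applied directly. Gaussian matrices. A real Gaussian random matrix has i.i.d. $N(0,1)$ entries. A complex Gaussian random matrix has i.i.d. entries whose real and imaginary parts are independent $N(0,1)$ variables. *)

(* Defs.v *)
From HB Require Import structures.
From mathcomp Require Import all_boot all_order all_algebra.
From mathcomp Require Import complex.
From mathcomp Require Import all_classical all_reals all_analysis.

Set Implicit Arguments.
Unset Strict Implicit.
Unset Printing Implicit Defensive.

Import Order.TTheory GRing.Theory Num.Theory.
Import numFieldNormedType.Exports.

Local Open Scope classical_set_scope.
Local Open Scope complex_scope.
Local Open Scope ring_scope.

(* The Borel sigma-algebra of R * R and the two-dimensional Lebesgue measure,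
   transported to R[i] by the identification of x + iy with (x, y). *)
Section ComplexPlane.
Context {R : realType}.

Definition plane_coord (z : R[i]) : R * R := (complex.Re z, complex.Im z).
Definition plane_point (p : R * R) : R[i] := p.1 +i* p.2.

HB.instance Definition _ := isPointed.Build R[i] 0.

HB.instance Definition _ :=
  Measurable.copy R[i] (g_sigma_algebra_preimageType plane_coord).

Lemma measurable_plane_point : measurable_fun [set: R * R] plane_point.
Proof.
move=> _ A [B mB <-]; rewrite !setTI.
by rewrite [X in measurable X](_ : _ = B)//; apply/seteqP; split => -[].
Qed.

Definition plane_lebesgue : set R[i] -> \bar R :=
  pushforward (@lebesgue_measure R \x @lebesgue_measure R)%E plane_point.

HB.instance Definition _ := Measure.copy plane_lebesgue
  (measure_function_pushforward__canonical__measure_function_Measure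
    (@lebesgue_measure R \x @lebesgue_measure R)%E measurable_plane_point).

Definition domain (Omega : set R[i]) : Prop :=
  [/\ open (Omega : set R[i]^o), connected (Omega : set R[i]^o) &
      Omega !=set0].

End ComplexPlane.

Variant scalars := RealScalars | ComplexScalars.

Section Scalars.
Context (R : realType) (k : scalars).

Definition Kfield : numFieldType :=
  match k with RealScalars => R | ComplexScalars => R[i] end.

Definition Kdim : nat :=
  match k with RealScalars => 1 | ComplexScalars => 2 end.

End Scalars.

Section ScalarParts.
Context {R : realType} {k : scalars}.

Definition Kre : Kfield R k -> R :=
  match k return Kfield R k -> R with
  | RealScalars => fun x => x
  | ComplexScalars => fun x => complex.Re x
  end.

Definition Kim : Kfield R k -> R :=
  match k return Kfield R k -> R with
  | RealScalars => fun=> 0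
  | ComplexScalars => fun x => complex.Im x
  end.

(* Over the reals the second argument is ignored; it is only used with 0
   there. *)
Definition Kmk : R -> R -> Kfield R k :=
  match k return R -> R -> Kfield R k with
  | RealScalars => fun x _ => x
  | ComplexScalars => fun x y => x +i* y
  end.

Definition Kconj (x : Kfield R k) : Kfield R k :=
  Kmk (Kre x) (- Kim x).

Definition Kreal (x : R) : Kfield R k := Kmk x 0.

End ScalarParts.

Section L2.
Context {R : realType} {k : scalars}.
Local Notation K := (Kfield R k).
Variable Omega : set R[i].

Definition norm2_sq m (v : 'cV[K]_m) : R :=
  \sum_(i < m) (Kre (v i 0) ^+ 2 + Kim (v i 0) ^+ 2).

Definition measurable_vec m (h : R[i] -> 'cV[K]_m) : Prop :=
  forall i, measurable_fun Omega (fun z => Kre (h z i 0)) /\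
            measurable_fun Omega (fun z => Kim (h z i 0)).

(* Elements of L^2 are represented by functions; two functions represent the
   same element when they are related by aeeq. Values outside Omega are
   irrelevant. *)
Definition L2 m : set (R[i] -> 'cV[K]_m) :=
  [set h | measurable_vec h /\
           (\int[plane_lebesgue]_(z in Omega) (norm2_sq (h z))%:E < +oo)%E].

Definition aeeq m (g h : R[i] -> 'cV[K]_m) : Prop :=
  {ae plane_lebesgue, forall z, Omega z -> g z = h z}.

Definition L2norm m (h : R[i] -> 'cV[K]_m) : R :=
  Num.sqrt (\int[plane_lebesgue]_(z in Omega) norm2_sq (h z)).

(* A linear subspace of L^2, as the set of all representatives of its
   elements. *)
Definition L2subspace N (W : set (R[i] -> 'cV[K]_N)) : Prop :=
  [/\ W `<=` L2 (m := N),
      W (fun=> 0),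
      (forall (a : K) f g, W f -> W g -> W (fun z => a *: f z + g z)) &
      (forall f g, W f -> L2 g -> aeeq f g -> W g)].

(* A map from W to L^2, not assumed to be linear. The values of A outside W are
   irrelevant. *)
Definition L2operator N (W : set (R[i] -> 'cV[K]_N))
    (A : (R[i] -> 'cV[K]_N) -> (R[i] -> 'cV[K]_N)) : Prop :=
  (forall f, W f -> L2 (A f)) /\
  (forall f g, W f -> W g -> aeeq f g -> aeeq (A f) (A g)).

Definition commutes_with_linear_maps N (W : set (R[i] -> 'cV[K]_N))
    (A : (R[i] -> 'cV[K]_N) -> (R[i] -> 'cV[K]_N)) : Prop :=
  forall f (B : 'M[K]_N), W f ->
    W (fun z => B *m f z) /\
    aeeq (A (fun z => B *m f z)) (fun z => B *m A f z).

(* A on functions with values in K^m, m <= N: multiplication by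
   pid_mx m : 'M_(N, m) pads with N - m zeros, and multiplication by
   pid_mx m : 'M_(m, N) keeps the first m entries; both are the identity when
   m = N. *)
Definition short_op N (A : (R[i] -> 'cV[K]_N) -> (R[i] -> 'cV[K]_N)) m
    (f : R[i] -> 'cV[K]_m) : R[i] -> 'cV[K]_m :=
  fun z => pid_mx m *m A (fun y => pid_mx m *m f y) z.

(* The inner product of L^2, conjugate-linear in the second argument. *)
Definition L2inner (v w : R[i] -> 'cV[K]_1) : K :=
  Kmk
    (\int[plane_lebesgue]_(z in Omega)
       Kre (v z 0 0 * Kconj (w z 0 0)))
    (\int[plane_lebesgue]_(z in Omega)
       Kim (v z 0 0 * Kconj (w z 0 0))).

(* h = \sum_j sigma_j u_j v_j with orthonormal u_j in K^N and orthonormal v_j in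
   L^2 (v_j itself, not its conjugate, since the operator induced by h is
   v |-> \int h v). Only sigma 0, ..., sigma (N - 1) matter; the indices start
   at 0, so sigma 0 is the largest singular value. *)
Definition is_svd N (h : R[i] -> 'cV[K]_N) (u : 'I_N -> 'cV[K]_N)
    (v : 'I_N -> R[i] -> 'cV[K]_1) (sigma : nat -> R) : Prop :=
  [/\ (forall i j, \sum_(n < N) u i n 0 * Kconj (u j n 0) =
                   (i == j)%:R),
      (forall j, L2 (v j)) /\
        (forall i j, L2inner (v i) (v j) = (i == j)%:R),
      (forall i j : nat, (i <= j < N)%N -> 0 <= sigma j <= sigma i) &
      aeeq h (fun z => \sum_(j < N)
                 (Kreal (sigma j) * v j z 0 0) *: u j)].

(* The singular values do not depend on the decomposition, so [get] chooses from
   a singleton when j < N. *)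
Definition singular_value N (h : R[i] -> 'cV[K]_N) (j : nat) : R :=
  get [set s | exists u v sigma, is_svd h u v sigma /\ s = sigma j].

Definition stable_rank N (h : R[i] -> 'cV[K]_N) : R :=
  L2norm h ^+ 2 / singular_value h 0 ^+ 2.

End L2.

Section Gaussian.
Context d (T : measurableType d) (R : realType) (P : probability T R).

Definition mutually_independent d' (S : measurableType d') (I : finType)
    (X : I -> T -> S) : Prop :=
  forall (J : {set I}) (B : I -> set S), (forall i, measurable (B i)) ->
    P (\bigcap_(i in [set` J]) X i @^-1` B i) =
    (\prod_(i in J) P (X i @^-1` B i))%E.

Definition standard_normal (X : T -> R) : Prop :=
  measurable_fun setT X /\
  forall B : set R, measurable B -> P (X @^-1` B) = normal_prob 0 1 B.

Definition standard_gaussian (k : scalars) (X : T -> Kfield R k) : Prop :=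
  match k return (T -> Kfield R k) -> Prop with
  | RealScalars => fun X => standard_normal X
  | ComplexScalars => fun X =>
      [/\ standard_normal (fun t => complex.Re (X t)),
          standard_normal (fun t => complex.Im (X t)) &
          mutually_independent
            (fun (b : bool) t =>
               if b then complex.Im (X t) else complex.Re (X t))]
  end X.

(* For independence, the entries are regarded as random elements of the plane;
   over the reals the second coordinate is constantly 0. *)
Definition gaussian_matrix (k : scalars) m n
    (V : T -> 'M[Kfield R k]_(m, n)) : Prop :=
  (forall i j, standard_gaussian (fun t => V t i j)) /\
  mutually_independent (fun (ij : 'I_m * 'I_n) t =>
    (Kre (V t ij.1 ij.2), Kim (V t ij.1 ij.2))).

End Gaussian.

Section Gamma.
Context {R : realType}.

Definition Gamma (s : R) : R :=
  \int[@lebesgue_measure R]_(t in `[0, +oo[) (t `^ (s - 1) * expR (- t)).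

Definition lower_gamma (s x : R) : R :=
  \int[@lebesgue_measure R]_(t in `[0, x]) (t `^ (s - 1) * expR (- t)).

End Gamma.

(* Main.v *)
Require Import Defs.
From HB Require Import structures.
From mathcomp Require Import all_boot all_order all_algebra.
From mathcomp Require Import complex.
From mathcomp Require Import all_classical all_reals all_analysis.
From mathcomp Require Import measurable_realfun.
From mathcomp Require Import ring lra.

(** Write h = f - A f. Commutation with matrices is used once: padding V^T to a
square matrix shows that the error of the sketch V^T f is V^T h almost
everywhere, so both claims compare the norm of h with the norm of V^T h
([sketched_errorE]).

The singular value decomposition h = sum_j sigma_j u_j v_j separates what is
random from what is not. Since the v_j are orthonormal,
||V^T h||^2 = (1/(c l)) sum_j sigma_j^2 Y_j with Y_j = ||Vt^T u_j||^2
([svd_norm]). Orthonormality of the u_j makes the real coordinates of all the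
vectors Vt^T u_j an orthogonal transform of the real coordinates of Vt, which
are independent standard normal variables; hence the Y_j behave as independent
chi-square variables with c l degrees of freedom. The form in which this is
used is the joint moment generating function
E exp(sum_j c_j Y_j / 2) = prod_j (1 - c_j)^(- c l / 2)
for c_j < 1 ([gaussian_matrix_mgf]). It follows from one general identity for
quadratic forms of independent normal variables
([gaussian_quadratic_expectation]), in which each square is linearized by an
auxiliary normal variable.

Lower tail of the sketch: ||h|| >= tau ||V^T h|| forces
sigma_0^2 Y_0 / (c l) <= ||h||^2 / tau^2, that is
Y_0 / 2 <= c l rho tau^(-2) / 2, and Y_0 / 2 has the Gamma law of shape c l / 2.
The law is recognized from the Laplace transform at the nonnegative integers:
these values are the moments of exp(- Y_0 / 2), a variable in [0, 1], and the
moments determine distribution functions on [0, 1] by approximating indicators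
with Bernstein polynomials ([moment_comparison], [gamma_law_lower_tail]).

Upper tail of the sketch: with r_j = (sigma_j / sigma_0)^2, so that
rho = sum_j r_j, the event is sum_j r_j Y_j >= c l rho tau^2. The Chernoff bound
with parameter y = 1 - tau^(-2), together with
(1 - r y)^(-1/2) <= tau^r for 0 <= r <= 1 ([chi_square_mgf_bound]), bounds its
probability by exp(- (c l rho / 2) (tau^2 - 1 - 2 ln tau)), and
ln tau <= tau - 1 gives the stated bound ([energy_upper_tail]).

Two existence results are needed on the way: the spectral theorem for Hermitian
matrices over either field ([hermitian_diagonalization]), applied to the Gram
matrix of h, and enough orthonormal functions on Omega to complete the family
v_j when h has deficient rank ([L2_extend_orthonormal]). *)

Set Implicit Arguments.
Unset Strict Implicit.
Unset Printing Implicit Defensive.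

Import Order.TTheory GRing.Theory Num.Theory.
Import numFieldNormedType.Exports.

Local Open Scope classical_set_scope.
Local Open Scope complex_scope.
Local Open Scope ring_scope.

(** * Integration against image measures and products of independent variables *)

Section IntegralDensity.
Local Open Scope ereal_scope.
Import HBNNSimple.

(** The hypothesis identifies nu as the image under X of the measure of density Z
with respect to mu, so the equality holds for indicators; it passes to simple
functions by linearity and to all nonnegative f by monotone convergence. The
case Z = 1 is integration against a law, the case X = id integration against a
density. *)
Lemma ge0_integral_density d d' (T : measurableType d) (S : measurableType d')
  (R : realType) (mu : {measure set T -> \bar R}) (nu : {measure set S -> \bar R})
  (X : T -> S) (Z : T -> R) (f : S -> \bar R) :
  measurable_fun setT X -> measurable_fun setT Z -> (forall t, 0 <= Z t)%R ->
  (forall B, measurable B -> \int[mu]_(t in X @^-1` B) (Z t)%:E = nu B) ->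
  measurable_fun setT f -> (forall s, 0 <= f s) ->
  \int[mu]_t (f (X t) * (Z t)%:E) = \int[nu]_s f s.
Proof.
move=> mX mZ Z0 ZE mf f0.
pose h := nnsfun_approx measurableT mf.
have mh n : measurable_fun setT (h n \o X).
  by apply: measurableT_comp => //; exact/measurable_funP.
have -> : \int[nu]_s f s = lim (\int[nu]_s (EFin \o h n) s @[n --> \oo]).
  have fE s : f s = lim ((EFin \o h n) s @[n --> \oo]).
    by apply/esym/cvg_lim => //; exact: cvg_nnsfun_approx.
  under eq_integral => s _ do rewrite fE.
  apply: monotone_convergence => //.
  - by move=> n; apply/measurable_EFinP; exact/measurable_funP.
  - by move=> n x _ /=; rewrite lee_fin.
  - by move=> x _ a b ab; rewrite lee_fin; exact/lefP/nd_nnsfun_approx.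
have -> : \int[mu]_t (f (X t) * (Z t)%:E) =
    lim (\int[mu]_t (((h n (X t))%:E) * (Z t)%:E) @[n --> \oo]).
  have fE t : f (X t) * (Z t)%:E = lim ((h n (X t))%:E * (Z t)%:E @[n --> \oo]).
    apply/esym/cvg_lim => //.
    by apply: cvgeZr => //; exact: cvg_nnsfun_approx.
  under eq_integral => t _ do rewrite fE.
  apply: monotone_convergence => //.
  - by move=> n; apply: emeasurable_funM; apply/measurable_EFinP => //; exact: mh.
  - by move=> n x _; rewrite mule_ge0 ?lee_fin.
  - move=> x _ a b ab; rewrite lee_wpmul2r ?lee_fin //.
    exact/lefP/nd_nnsfun_approx.
suff suf n : \int[mu]_t ((h n (X t))%:E * (Z t)%:E) = \int[nu]_s (EFin \o h n) s.
  by under eq_fun do rewrite suf.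
transitivity (\int[nu]_s (\sum_(y \in range (h n))
    (y * \1_(h n @^-1` [set y]) s)%:E)); last first.
  by apply: eq_integral => t tE; rewrite /= fimfunE -fsumEFin.
have mhS y : measurable (h n @^-1` [set y]) by [].
rewrite ge0_integral_fsum//; last 2 first.
  - by move=> y; apply/measurable_EFinP; exact: measurable_funM.
  - by move=> y x _; exact: nnfun_muleindic_ge0.
transitivity (\int[mu]_t (\sum_(y \in range (h n))
    (y * \1_(h n @^-1` [set y]) (X t))%:E * (Z t)%:E)).
  apply: eq_integral => t _.
  rewrite -ge0_mule_fsuml => [|y]; last exact: nnfun_muleindic_ge0.
  by rewrite fsumEFin// -(fimfunE _ (X t)).
rewrite ge0_integral_fsum//; last 2 first.
  - move=> y; apply: emeasurable_funM; apply/measurable_EFinP => //.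
    by apply: measurable_funM => //; apply: measurableT_comp.
  - by move=> y x _; rewrite mule_ge0 ?nnfun_muleindic_ge0 ?lee_fin.
apply: eq_fsbigr => r rhn.
have r0 : (0 <= r)%R by move: rhn; rewrite inE => -[s _ <-].
transitivity (r%:E * nu (h n @^-1` [set r])).
  transitivity (\int[mu]_t
      (r%:E * ((\1_(h n @^-1` [set r]) (X t))%:E * (Z t)%:E))).
    by apply: eq_integral => t _; rewrite EFinM muleA.
  rewrite ge0_integralZl//; last 2 first.
  - apply: emeasurable_funM; apply/measurable_EFinP => //.
    by apply: measurableT_comp.
  - by move=> t _; rewrite mule_ge0 ?lee_fin.
  congr (_ * _); rewrite -ZE// [RHS]integral_mkcond.
  by apply: eq_integral => t _; rewrite epatch_indic muleC.
rewrite -[X in nu X]setIT -integral_indic// -ge0_integralZl ?lee_fin//.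
exact/measurable_EFinP.
Qed.

End IntegralDensity.

Section Independence.
Context d (T : measurableType d) (R : realType) (P : probability T R).
Variables (I : finType) (X : I -> T -> R).
Hypothesis mX : forall i, measurable_fun setT (X i).
Hypothesis indepX : forall B : I -> set R, (forall i, measurable (B i)) ->
  P [set t | forall i, B i (X i t)] = (\prod_i P (X i @^-1` B i))%E.

(** Induction on the number of factors that are not indicators. When all of them
are, the claim is the hypothesis. To free the factor of index a, fix the others:
by induction, B |-> E[1_B(X_a) prod_(i != a) psi_i(X_i)] is a constant multiple
of the law of X_a, and psi_a is integrated against that measure. *)
Lemma independent_expectation_prod (psi : I -> R -> R) :
  (forall i, measurable_fun setT (psi i)) -> (forall i x, 0 <= psi i x) ->
  (forall i, \int[P]_t (psi i (X i t))%:E < +oo)%E ->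
  (\int[P]_t (\prod_i psi i (X i t))%:E =
   \prod_i \int[P]_t (psi i (X i t))%:E)%E.
Proof.
move=> mpsi psi0 psioo.
have : forall i, i \notin enum I ->
    exists2 B, measurable B & psi i = \1_B :> (R -> R).
  by move=> i; rewrite mem_enum.
(* The list holds the indices whose factor may be an arbitrary function. *)
elim: (enum I) psi mpsi psi0 psioo => [|a s IH] psi mpsi psi0 psioo psiB.
  have /choice[B BP] : forall i, exists B, measurable B /\ psi i = \1_B :> (R -> R).
    by move=> i; have [//|B mB ->] := psiB i; exists B.
  have psiE i t : psi i (X i t) = \1_(X i @^-1` B i) t.
    by rewrite (BP i).2 /= !indicE.
  have mBX i : measurable (X i @^-1` B i).
    by rewrite -[X in measurable X]setTI; apply: mX => //; exact: (BP i).1.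
  under [RHS]eq_bigr => i _.
    under eq_integral do rewrite psiE.
    rewrite integral_indic// setIT; over.
  rewrite -indepX; last by move=> i; exact: (BP i).1.
  rewrite -[X in P X]setIT -integral_indic//; last first.
    rewrite [X in measurable X](_ : _ = \bigcap_(i in [set: I]) (X i @^-1` B i)).
      apply: fin_bigcap_measurable => //; exact: finite_finset.
    by apply/seteqP; split => t /= h i => [_|]; apply: h.
  apply: eq_integral => t _; congr EFin.
  under eq_bigr do rewrite psiE.
  rewrite indicE; have [tB|tB] := boolP (t \in _).
    rewrite big1// => i _; rewrite indicE.
    by move: tB; rewrite inE => /(_ i) tB; rewrite mem_set.
  move: tB; rewrite notin_setE => /existsNP[i Bi].
  by rewrite (bigD1 i)//= indicE memNset ?mul0r.
have [as_|as_] := boolP (a \in s).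
  apply: IH => // i is_; apply: psiB; rewrite inE negb_or is_ andbT.
  by apply: contraNneq is_ => ->.
pose Z t := \prod_(i | i != a) psi i (X i t).
have psiX0 i : (0 <= \int[P]_t (psi i (X i t))%:E)%E.
  by apply: integral_ge0 => t _; rewrite lee_fin.
have cfin : (\prod_(i | i != a) \int[P]_t (psi i (X i t))%:E)%E \is a fin_num.
  by elim/big_rec : _ => // i x _ xfin; rewrite fin_numM// ge0_fin_numE.
set cc := (\prod_(i | i != a) _)%E in cfin.
have cc0 : 0 <= fine cc.
  by apply: fine_ge0; exact: prode_ge0.
pose c := NngNum cc0.
pose Xa := HB.pack_for {mfun T >-> R} (X a)
  (@isMeasurableFun.Build _ _ _ _ (X a) (mX a)).
have mpsiX i : measurable_fun setT (fun t => psi i (X i t)).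
  exact: (measurableT_comp (mpsi i) (mX i)).
have mZ : measurable_fun setT Z.
  by rewrite /Z; under eq_fun do rewrite -big_filter; exact: measurable_prod.
have Z0 t : 0 <= Z t by apply: prodr_ge0.
have main B : measurable B ->
    (\int[P]_(t in X a @^-1` B) (Z t)%:E = mscale c (distribution P Xa) B)%E.
  move=> mB; pose psi' i := if i == a then (\1_B : R -> R) else psi i.
  have mXB : measurable (X a @^-1` B).
    by rewrite -[X in measurable X]setTI; exact: mX.
  have eB : (\int[P]_t ((\1_B (X a t))%:E : \bar R) = P (X a @^-1` B))%E.
    by rewrite -[X in P X]setIT -integral_indic.
  have H : (\int[P]_t (\prod_i psi' i (X i t))%:E = P (X a @^-1` B) * cc)%E.
    rewrite IH.
    - rewrite (bigD1 a)//= {1}/psi' eqxx eB; congr (_ * _)%E.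
      by apply: eq_bigr => i /negbTE ia; rewrite /psi' ia.
    - by move=> i; rewrite /psi'; case: ifP.
    - by move=> i x; rewrite /psi'; case: ifP.
    - move=> i; rewrite /psi'; case: ifP => [/eqP ->|//].
      by rewrite eB (le_lt_trans (probability_le1 _ _))// ltry.
    - move=> i is_; rewrite /psi'; case: ifPn => [_|ia]; first by exists B.
      by apply: psiB; rewrite inE negb_or ia.
  rewrite /mscale/= fineK// muleC /distribution /pushforward/= -[RHS]H.
  rewrite [LHS]integral_mkcond; apply: eq_integral => t _.
  rewrite epatch_indic -EFinM; congr EFin.
  rewrite [RHS](bigD1 a)//= {1}/psi' eqxx [LHS]mulrC; congr (_ * _).
  by apply: eq_bigr => i /negbTE ia; rewrite /psi' ia.
transitivity (\int[P]_t ((psi a (X a t))%:E * (Z t)%:E))%E.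
  by apply: eq_integral => t _; rewrite (bigD1 a).
rewrite (ge0_integral_density (nu := mscale c (distribution P Xa))
  (f := EFin \o psi a))//=; last 2 first.
- by apply/measurable_EFinP.
- by move=> x; rewrite lee_fin.
rewrite ge0_integral_mscale//=; last 2 first.
- by apply/measurable_EFinP.
- by move=> x _; rewrite lee_fin.
rewrite fineK// ge0_integral_distribution//=; last 2 first.
- by apply/measurable_EFinP.
- by move=> x; rewrite lee_fin.
by rewrite [RHS](bigD1 a)//= -/cc muleC.
Qed.

End Independence.

(** * Exponential moments of Gaussian quadratic forms *)

Section NormalIntegrals.
Context (R : realType).

Lemma ge0_integral_normal_prob (m s : R) (f : R -> \bar R) :
  measurable_fun setT f -> (forall x, 0 <= f x)%E ->
  (\int[normal_prob m s]_x f x =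
   \int[lebesgue_measure]_x (f x * (normal_pdf m s x)%:E))%E.
Proof.
move=> mf f0; apply/esym.
apply: (ge0_integral_density (X := id) (nu := normal_prob m s)) => //.
- exact: measurable_normal_pdf.
- by move=> x; exact: normal_pdf_ge0.
Qed.

(** Completing the square: the integrand times the standard normal density is a
multiple of the normal density of mean b / (1 - s) and variance 1 / (1 - s). *)
Lemma integral_normal_expR_quadratic (b s : R) : s < 1 ->
  (\int[normal_prob 0 1]_x (expR (b * x + s * x ^+ 2 / 2))%:E =
   ((Num.sqrt (1 - s))^-1 * expR (b ^+ 2 / (1 - s) / 2))%:E)%E.
Proof.
move=> s1; have s1' : 0 < 1 - s by rewrite subr_gt0.
have mexp : measurable_fun setT (fun x : R => expR (b * x + s * x ^+ 2 / 2)).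
  apply: measurableT_comp => //; apply: measurable_funD => //.
  by apply: measurable_funM => //; apply: measurable_funM => //; exact: measurable_funX.
rewrite ge0_integral_normal_prob; last 2 first.
- by apply/measurable_EFinP.
- by move=> x; rewrite lee_fin expR_ge0.
set q := Num.sqrt (1 - s).
have q0 : 0 < q by rewrite sqrtr_gt0.
have qq : q ^+ 2 = 1 - s by rewrite sqr_sqrtr// ltW.
pose C := q^-1 * expR (b ^+ 2 / (1 - s) / 2).
have C0 : 0 <= C by rewrite mulr_ge0 ?expR_ge0// invr_ge0 ltW.
transitivity (\int[lebesgue_measure]_x
    (C%:E * (normal_pdf (b / (1 - s)) q^-1 x)%:E))%E; last first.
  rewrite ge0_integralZl//; last 2 first.
  - by apply/measurable_EFinP; exact: measurable_normal_pdf.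
  - by move=> x _; rewrite lee_fin normal_pdf_ge0.
  by rewrite integral_normal_pdf mule1.
apply: eq_integral => x _; rewrite -!EFinM; congr EFin.
rewrite !normal_pdfE ?oner_neq0 ?invr_neq0 ?gt_eqF//.
rewrite /C /normal_peak /normal_fun.
rewrite [Num.sqrt (q^-1 ^+ 2 * _ *+ 2)](_ : _ = q^-1 * Num.sqrt (1 ^+ 2 * pi *+ 2)); last first.
  rewrite -mulrnAr sqrtrM ?sqr_ge0// sqrtr_sqr ger0_norm ?invr_ge0 ?ltW//.
  by rewrite expr1n mul1r.
rewrite invfM invrK.
set p := (Num.sqrt (1 ^+ 2 * _ *+ 2))^-1.
rewrite mulrCA -expRD mulrACA [q^-1 * (q * p)]mulrA mulVf ?gt_eqF// mul1r.
rewrite -mulrA -expRD; congr (_ * expR _).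
rewrite exprVn qq; field.
by rewrite gt_eqF.
Qed.

Context d (T : measurableType d) (P : probability T R).

Lemma standard_normal_expectation (X : T -> R) (f : R -> \bar R) :
  standard_normal P X -> measurable_fun setT f -> (forall x, 0 <= f x)%E ->
  (\int[P]_t f (X t) = \int[normal_prob 0 1]_x f x)%E.
Proof.
move=> [mX PX] mf f0.
have := @ge0_integral_density _ _ _ _ _ P (normal_prob 0 1) X (cst 1) f mX.
move=> <- //; first by apply: eq_integral => t _; rewrite mule1.
move=> B mB; have mXB : measurable (X @^-1` B).
  by rewrite -[_ @^-1` _]setTI; exact: mX.
by rewrite (integral_cst P mXB 1%E) mul1e; exact: PX.
Qed.

End NormalIntegrals.

Lemma ge0_integralZl_fin d (T : measurableType d) (R : realType)
    (mu : {measure set T -> \bar R}) (k : R) (g : T -> R) :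
  measurable_fun setT g -> (forall x, 0 <= g x) -> 0 <= k ->
  (\int[mu]_x (k%:E * (g x)%:E) = k%:E * \int[mu]_x (g x)%:E)%E.
Proof.
move=> mg g0 k0; rewrite ge0_integralZl//.
- exact/measurable_EFinP.
- by move=> x _; rewrite lee_fin.
Qed.

Section GaussianQuadratic.
Context d (T : measurableType d) (R : realType) (P : probability T R).
Context (I : finType) (X : I -> T -> R).
Hypothesis nX : forall i, standard_normal P (X i).
Hypothesis indepX : forall B : I -> set R, (forall i, measurable (B i)) ->
  P [set t | forall i, B i (X i t)] = (\prod_i P (X i @^-1` B i))%E.

Let mX i : measurable_fun setT (X i). Proof. exact: (nX i).1. Qed.

Lemma gaussian_diagonal_expectation (a : R) (b : I -> R) : 0 <= a ->
  (\int[P]_t (expR (\sum_i (b i * X i t - a * X i t ^+ 2 / 2)))%:E =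
   ((Num.sqrt (1 + a))^-1 ^+ #|I| *
    expR ((\sum_i b i ^+ 2) / (1 + a) / 2))%:E)%E.
Proof.
move=> a0; pose psi i x := expR (b i * x + - a * x ^+ 2 / 2).
have mpsi i : measurable_fun setT (psi i).
  apply: measurableT_comp => //; apply: measurable_funD => //.
  by apply: measurable_funM => //; apply: measurable_funM => //; exact: measurable_funX.
have psiE i : (\int[P]_t (psi i (X i t))%:E =
    ((Num.sqrt (1 + a))^-1 * expR (b i ^+ 2 / (1 + a) / 2))%:E)%E.
  rewrite (standard_normal_expectation (f := EFin \o psi i) (nX i)); last 2 first.
  - by apply/measurable_EFinP.
  - by move=> x; rewrite lee_fin expR_ge0.
  by rewrite integral_normal_expR_quadratic ?opprK// (le_lt_trans _ ltr01)// oppr_le0.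
transitivity (\int[P]_t (\prod_i psi i (X i t))%:E)%E.
  apply: eq_integral => t _; congr EFin; rewrite expR_sum.
  by apply: eq_bigr => i _; rewrite /psi mulNr mulNr.
rewrite independent_expectation_prod//; last 2 first.
- by move=> i x; exact: expR_ge0.
- by move=> i; rewrite psiE ltry.
under eq_bigr do rewrite psiE.
rewrite prodEFin; congr EFin; rewrite big_split/= prodr_const; congr (_ * _).
by rewrite -expR_sum !mulr_suml.
Qed.

Let dot (u v : I -> R) : R := \sum_i u i * v i.

Let measurable_dot u : measurable_fun setT (fun t => dot u (X^~ t)).
Proof. by apply: measurable_sum => i; exact: measurable_funM. Qed.

(** Each square is linearized by an auxiliary standard normal variable z, through
exp(c y^2 / 2) = E_z exp(sqrt(c) z y). After exchanging the two integrals, the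
square of index j has become a shift of the vector b by sqrt(c_j) z w_j, and
the remaining squares are treated by induction; this is why b is arbitrary. The
damping term - a |X|^2 / 2 keeps the integral finite for c_j up to 1 + a, and
orthogonality of the w_j makes the shift invisible to the remaining squares. *)
Lemma gaussian_partial_quadratic_expectation (J : eqType) (w : J -> I -> R)
    (a : R) (c : J -> R) (s : seq J) (b : I -> R) :
  (forall j k, \sum_i w j i * w k i = (j == k)%:R) ->
  0 <= a -> (forall j, 0 <= c j < 1 + a) -> uniq s ->
  (\int[P]_t (expR (\sum_i (b i * X i t - a * X i t ^+ 2 / 2) +
      \sum_(j <- s) c j * (\sum_i w j i * X i t) ^+ 2 / 2))%:E =
   ((Num.sqrt (1 + a))^-1 ^+ #|I| *
    (\prod_(j <- s) (Num.sqrt (1 - c j / (1 + a)))^-1) *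
    expR ((\sum_i b i ^+ 2) / (1 + a) / 2 +
      \sum_(j <- s) (\sum_i w j i * b i) ^+ 2 *
        (c j / ((1 + a) * (1 + a - c j))) / 2))%:E)%E.
Proof.
move=> worth a0 cP.
elim: s b => [b _|j s IH b /= /andP[js us]].
  rewrite !big_nil addr0 mulr1 -gaussian_diagonal_expectation//.
  by under eq_integral do rewrite big_nil addr0.
have r0 : 0 < 1 + a by rewrite ltr_wpDr.
have /andP[c0 c1] := cP j.
pose F (p : T * R) := expR (\sum_i (b i * X i p.1 - a * X i p.1 ^+ 2 / 2) +
      \sum_(j <- s) c j * (\sum_i w j i * X i p.1) ^+ 2 / 2 +
      Num.sqrt (c j) * (\sum_i w j i * X i p.1) * p.2).
have mX1 i : measurable_fun setT (fun p : T * R => X i p.1).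
  exact: (measurableT_comp (mX i) measurable_fst).
have md1 u : measurable_fun setT (fun p : T * R => \sum_i u i * X i p.1).
  exact: (measurableT_comp (measurable_dot u) measurable_fst).
have mF : measurable_fun setT F.
  apply: measurableT_comp => //; apply: measurable_funD; last first.
    by apply: measurable_funM => //; exact: measurable_funM.
  apply: measurable_funD.
    apply: measurable_sum => i; apply: measurable_funB; first exact: measurable_funM.
    by apply: measurable_funM => //; apply: measurable_funM => //; exact: measurable_funX.
  apply: measurable_sum => k.
  by apply: measurable_funM => //; apply: measurable_funM => //; exact: measurable_funX.
transitivity (\int[P]_t \int[normal_prob 0 1]_z (F (t, z))%:E)%E.
  apply: eq_integral => t _; rewrite /F/= big_cons.
  set A := \sum_i _; set B := \sum_(j <- s) _; set y := \sum_i _.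
  transitivity (\int[normal_prob 0 1]_z ((expR (A + B))%:E *
      (expR (Num.sqrt (c j) * y * z + 0 * z ^+ 2 / 2))%:E))%E; last first.
    by apply: eq_integral => z _; rewrite mul0r mul0r addr0 -EFinM -expRD.
  rewrite ge0_integralZl_fin//; last first.
    apply: measurableT_comp => //; apply: measurable_funD => //.
    by apply: measurable_funM => //; apply: measurable_funM => //; exact: measurable_funX.
  rewrite integral_normal_expR_quadratic//.
  rewrite !subr0 sqrtr1 invr1 mul1r mulr1 -EFinM -expRD; congr (expR _)%:E.
  by rewrite exprMn sqr_sqrtr//; ring.
transitivity (\int[normal_prob 0 1]_z \int[P]_t (F (t, z))%:E)%E.
  apply: (@fubini_tonelli _ _ T (measurableTypeR R) R P (normal_prob 0 1)
    (EFin \o F)); first exact/measurable_EFinP.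
  by move=> p; rewrite lee_fin expR_ge0.
pose beta := \sum_i w j i * b i.
pose K := (Num.sqrt (1 + a))^-1 ^+ #|I| *
    (\prod_(j <- s) (Num.sqrt (1 - c j / (1 + a)))^-1).
pose S := (\sum_i b i ^+ 2) / (1 + a) / 2 +
   \sum_(j <- s) (\sum_i w j i * b i) ^+ 2 *
        (c j / ((1 + a) * (1 + a - c j))) / 2.
have K0 : 0 <= K.
  rewrite mulr_ge0 ?exprn_ge0 ?invr_ge0 ?sqrtr_ge0//.
  by apply: prodr_ge0 => k _; rewrite invr_ge0 sqrtr_ge0.
transitivity (\int[normal_prob 0 1]_z ((K * expR S)%:E *
  (expR (Num.sqrt (c j) * beta / (1 + a) * z + c j / (1 + a) * z ^+ 2 / 2))%:E))%E.
  apply: eq_integral => z _.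
  transitivity (\int[P]_t (expR (\sum_i ((b i + Num.sqrt (c j) * z * w j i) * X i t
      - a * X i t ^+ 2 / 2) +
      \sum_(j <- s) c j * (\sum_i w j i * X i t) ^+ 2 / 2))%:E)%E.
    apply: eq_integral => t _; rewrite /F/=; congr (expR _)%:E.
    rewrite addrAC; congr (_ + _).
    rewrite [Num.sqrt (c j) * _ * _]mulrAC mulr_sumr -big_split/=.
    by apply: eq_bigr => i _; ring.
  rewrite IH// -/K -EFinM -[K * expR S * _]mulrA -expRD; congr (_ * expR _)%:E.
  have -> : \sum_i (b i + Num.sqrt (c j) * z * w j i) ^+ 2 =
     \sum_i b i ^+ 2 + 2 * Num.sqrt (c j) * z * beta + c j * z ^+ 2.
    transitivity (\sum_i (b i ^+ 2 + 2 * Num.sqrt (c j) * z * (w j i * b i)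
        + Num.sqrt (c j) ^+ 2 * z ^+ 2 * (w j i * w j i))).
      by apply: eq_bigr => i _; ring.
    rewrite !big_split/= -!mulr_sumr worth eqxx mulr1 sqr_sqrtr//.
  have -> : \sum_(j0 <- s) (\sum_i w j0 i * (b i + Num.sqrt (c j) * z * w j i)) ^+ 2 *
        (c j0 / ((1 + a) * (1 + a - c j0))) / 2 =
      \sum_(j <- s) (\sum_i w j i * b i) ^+ 2 *
        (c j / ((1 + a) * (1 + a - c j))) / 2.
    apply: eq_big_seq => k ks; congr (_ ^+ 2 * _ / _).
    transitivity (\sum_i (w k i * b i + Num.sqrt (c j) * z * (w k i * w j i))).
      by apply: eq_bigr => i _; ring.
    rewrite big_split/= -mulr_sumr worth.
    have /negbTE -> : k != j by apply: contraNneq js => <-.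
    by rewrite mulr0 addr0.
  rewrite /S; set U := \sum_i _; set V := \sum_(_ <- s) _; field.
  by rewrite gt_eqF.
rewrite ge0_integralZl_fin; last 3 first.
- apply: measurableT_comp => //; apply: measurable_funD => //.
  by apply: measurable_funM => //; apply: measurable_funM => //; exact: measurable_funX.
- by move=> z; exact: expR_ge0.
- by rewrite mulr_ge0 ?expR_ge0.
have rc : 0 < 1 + a - c j by rewrite subr_gt0.
rewrite integral_normal_expR_quadratic; last by rewrite ltr_pdivrMr// mul1r.
rewrite -EFinM !big_cons; congr EFin.
rewrite /K mulrACA -expRD !mulrA; congr (_ * expR _).
  by rewrite -!mulrA; congr (_ * _); rewrite mulrC.
rewrite /S -addrA [_ + (_ / 2)]addrC; congr (_ + (_ + _)).
rewrite -/beta !exprMn sqr_sqrtr//; field.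
by rewrite !gt_eqF.
Qed.

End GaussianQuadratic.

(** For a complete orthonormal system, sum_j (w_j . X)^2 = |X|^2, so adding the
same a to all the coefficients is compensated by the damping term
- a |X|^2 / 2. Taking a = sum_j |c_j| makes all the coefficients nonnegative, as
the linearization by sqrt(c_j) requires. *)
Lemma gaussian_quadratic_expectation d (T : measurableType d) (R : realType)
    (P : probability T R) (I J : finType) (X : I -> T -> R) (w : J -> I -> R)
    (c : J -> R) :
  (forall i, standard_normal P (X i)) ->
  (forall B : I -> set R, (forall i, measurable (B i)) ->
    P [set t | forall i, B i (X i t)] = (\prod_i P (X i @^-1` B i))%E) ->
  (forall j k, \sum_i w j i * w k i = (j == k)%:R) ->
  (forall x : I -> R, \sum_j (\sum_i w j i * x i) ^+ 2 = \sum_i x i ^+ 2) ->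
  (forall j, c j < 1) ->
  (\int[P]_t (expR (\sum_j c j * (\sum_i w j i * X i t) ^+ 2 / 2))%:E =
   (\prod_j (Num.sqrt (1 - c j))^-1)%:E)%E.
Proof.
move=> nX indepX worth wfull c1.
pose a := \sum_j `|c j|.
have a0 : 0 <= a by exact: sumr_ge0.
have r0 : 0 < 1 + a by rewrite ltr_wpDr.
(* Both cardinals equal the sum of the squares of all the weights. *)
have card : #|I| = #|J|.
  apply/eqP; rewrite -(eqr_nat R); apply/eqP.
  transitivity (\sum_i \sum_j w j i ^+ 2).
    rewrite -sumr_const; apply: eq_bigr => i _.
    have <- : \sum_k ((k == i)%:R : R) ^+ 2 = 1.
      rewrite (bigD1 i)//= eqxx expr1n big1 ?addr0// => k /negbTE ->.
      by rewrite expr0n.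
    rewrite -(wfull (fun k => (k == i)%:R)).
    apply: eq_bigr => j _; congr (_ ^+ 2).
    rewrite (bigD1 i)//= eqxx mulr1 big1 ?addr0// => k /negbTE ->.
    by rewrite mulr0.
  rewrite exchange_big/= -sumr_const; apply: eq_bigr => j _.
  by under eq_bigr do rewrite expr2; rewrite worth eqxx.
have ca j : 0 <= c j + a < 1 + a.
  rewrite ltrD2r c1 andbT /a (bigD1 j)//= addrA addr_ge0 ?sumr_ge0//.
  by rewrite -lerBlDl sub0r -normrN ler_norm.
have := gaussian_partial_quadratic_expectation nX indepX (fun=> 0) worth a0 ca
  (index_enum_uniq J).
rewrite [X in _ = X]/=.
under eq_integral => t _.
  rewrite (_ : _ + _ = \sum_j c j * (\sum_i w j i * X i t) ^+ 2 / 2); last first.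
    have -> : \sum_i (0 * X i t - a * X i t ^+ 2 / 2) =
        (- a / 2) * \sum_i (X i t) ^+ 2.
      by rewrite mulr_sumr; apply: eq_bigr => i _; ring.
    rewrite -(wfull (fun i => X i t)) mulr_sumr -big_split/=.
    by apply: eq_bigr => j _; ring.
  over.
move=> ->; congr EFin.
rewrite [expR _](_ : _ = 1); last first.
  rewrite -[RHS]expR0; congr expR; rewrite big1 ?mul0r ?add0r => [|i _]; last by rewrite expr0n.
  rewrite big1// => j _; rewrite big1 ?expr0n ?mul0r// => i _.
  by rewrite mulr0.
rewrite mulr1 card -prodr_const -big_split/=; apply: eq_bigr => j _.
rewrite -invfM -sqrtrM ?ltW//; congr (Num.sqrt _)^-1; field.
by rewrite gt_eqF.
Qed.

(** * Moments determine distribution functions on the unit interval *)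

Section MomentComparison.
Context (R : realType).

Definition bounded_measurable (phi : R -> R) :=
  measurable_fun setT phi /\
  exists M, forall x, 0 <= x <= 1 -> `|phi x| <= M.

(** An interface shared by expectations of a [0, 1]-valued random variable and
integrals against a density: linearity and monotonicity on bounded measurable
functions are all that the comparison of moments uses. *)
Definition positive_functional (L : (R -> R) -> R) :=
  (forall a phi psi, bounded_measurable phi -> bounded_measurable psi ->
    L (fun x => a * phi x + psi x) = a * L phi + L psi) /\
  (forall phi psi, bounded_measurable phi -> bounded_measurable psi ->
    (forall x, 0 <= x <= 1 -> phi x <= psi x) -> L phi <= L psi).

Lemma positive_functional_integral d (T : measurableType d)
    (mu : {measure set T -> \bar R}) (U g : T -> R) :
  measurable_fun setT U -> (forall t, 0 <= U t <= 1) ->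
  (forall t, 0 <= g t) -> mu.-integrable setT (EFin \o g) ->
  positive_functional (fun phi => \int[mu]_t (phi (U t) * g t)).
Proof.
move=> mU U01 g0 ig.
have ib phi : bounded_measurable phi ->
    mu.-integrable setT (EFin \o (fun t => phi (U t) * g t)).
  move=> [mphi [M phiM]].
  apply: (integrableMr measurableT (h := phi \o U) (g := EFin \o g)) => //.
    exact: measurableT_comp.
  exists `|M|; split; first exact: normr_real.
  move=> r Mr t _ /=; apply: (le_trans (phiM _ (U01 t))).
  exact: (le_trans (ler_norm _) (ltW Mr)).
split=> [a phi psi bphi bpsi|phi psi bphi bpsi le].
  have -> : (fun t => (a * phi (U t) + psi (U t)) * g t) =
      (fun t => a * (phi (U t) * g t) + psi (U t) * g t).
    by apply/funext => t; rewrite mulrDl mulrA.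
  have ia : mu.-integrable setT (EFin \o (fun t => a * (phi (U t) * g t))).
    have := integrableZl measurableT a (ib _ bphi).
    by apply: eq_integrable => //.
  rewrite RintegralD//; last exact: ib.
  by rewrite RintegralZl//; exact: ib.
apply: le_Rintegral => //; [exact: ib|exact: ib|move=> t _].
by rewrite ler_wpM2r// le.
Qed.

(** The Bernstein polynomial sum_k C(n, k) phi(k) x^k (1 - x)^(n - k), the
expectation of phi at the number of heads in n tosses of a coin of bias x; the
recursion conditions on one toss, and turns each fact about binomial
expectations into a short induction. *)
Fixpoint bernstein (n : nat) (phi : nat -> R) : {poly R} :=
  if n is m.+1 then
    'X * bernstein m (phi \o S) + (1 - 'X) * bernstein m phi
  else (phi 0%N)%:P.

Lemma bernsteinE n phi x : (bernstein n.+1 phi).[x] =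
  x * (bernstein n (phi \o S)).[x] + (1 - x) * (bernstein n phi).[x].
Proof. by rewrite /= !hornerE. Qed.

Lemma bernstein_le n phi psi x : 0 <= x <= 1 -> (forall k, phi k <= psi k) ->
  (bernstein n phi).[x] <= (bernstein n psi).[x].
Proof.
move=> /andP[x0 x1]; elim: n phi psi => [|n IH] phi psi le.
  by rewrite /= !hornerE.
rewrite !bernsteinE lerD// ler_wpM2l ?subr_ge0 ?IH//.
by move=> k; exact: le.
Qed.

Lemma bernstein_linear n a b phi psi x :
  (bernstein n (fun k => a * phi k + b * psi k)).[x] =
  a * (bernstein n phi).[x] + b * (bernstein n psi).[x].
Proof.
elim: n phi psi => [|n IH] phi psi; first by rewrite /= !hornerE.
by rewrite !bernsteinE IH (IH (phi \o S) (psi \o S)); ring.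
Qed.

Lemma bernstein_cst n a x : (bernstein n (fun=> a)).[x] = a.
Proof.
elim: n => [|n IH]; first by rewrite /= hornerE.
by rewrite bernsteinE IH -mulrDl addrC subrK mul1r.
Qed.

(** The second moment about a of a binomial variable: variance plus squared
bias. *)
Lemma bernstein_variance n a x :
  (bernstein n (fun k => (k%:R - a) ^+ 2)).[x] =
  n%:R * (x * (1 - x)) + (n%:R * x - a) ^+ 2.
Proof.
elim: n a => [|n IH] a; first by rewrite /= hornerE; ring.
rewrite bernsteinE.
have -> : (fun k => (k%:R - a) ^+ 2) \o S = fun k => (k%:R - (a - 1)) ^+ 2 :> R.
  by apply/funext => k /=; rewrite -natr1; ring.
by rewrite !IH -natr1; ring.
Qed.

Lemma bounded_measurable_horner (p : {poly R}) :
  bounded_measurable (fun x => p.[x]).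
Proof.
split.
  apply: continuous_measurable_fun; exact: continuous_horner.
exists (\sum_(i < size p) `|p`_i|) => x /andP[x0 x1].
rewrite horner_coef (le_trans (ler_norm_sum _ _ _))//; apply: ler_sum => i _.
by rewrite normrM normrX (ger0_norm x0) ler_piMr// exprn_ile1.
Qed.

Lemma positive_functional_horner (L1 L2 : (R -> R) -> R) (p : {poly R}) :
  positive_functional L1 -> positive_functional L2 ->
  (forall n, L1 (fun x => x ^+ n) = L2 (fun x => x ^+ n)) ->
  L1 (fun x => p.[x]) = L2 (fun x => p.[x]).
Proof.
move=> [L1l _] [L2l _] Lmom.
have L0 L : (forall a phi psi, bounded_measurable phi -> bounded_measurable psi ->
    L (fun x => a * phi x + psi x) = a * L phi + L psi) -> L (fun x => 0.[x]) = 0.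
  move=> /(_ (-1) (fun x => 0.[x]) (fun x => 0.[x])).
  move=> /(_ (bounded_measurable_horner 0) (bounded_measurable_horner 0)).
  rewrite mulN1r addNr => <-; congr L; apply/funext => x.
  by rewrite horner0 mulr0 addr0.
rewrite -(coefK p) poly_def.
elim/big_ind : _ => [|q r Hq Hr|i _].
- by rewrite !L0.
- have E : (fun x => (q + r).[x]) = (fun x => 1 * q.[x] + r.[x]).
    by apply/funext => x; rewrite hornerD mul1r.
  by rewrite E L1l ?L2l ?Hq ?Hr//; exact: bounded_measurable_horner.
- have E : (fun x => (p`_i *: 'X^i).[x]) = (fun x => p`_i * x ^+ i + 0.[x]).
    by apply/funext => x; rewrite hornerZ hornerXn horner0 addr0.
  have bX : bounded_measurable (fun x => x ^+ i).
    have := bounded_measurable_horner 'X^i; congr bounded_measurable.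
    by apply/funext => x; rewrite hornerXn.
  by rewrite E L1l ?L2l ?L0 ?Lmom//; exact: bounded_measurable_horner.
Qed.

(** By hypothesis the two functionals agree on polynomials. A polynomial lying
between the indicators of [c1 <= x] and [c2 < x] up to a small constant is
needed: take the Bernstein polynomial of the indicator of [k >= n c], c the
midpoint of c2 and c1. By the Chebyshev inequality for the binomial variable of
mean n x, the error is at most 1 / (n e^2) outside ]c - e, c + e[, which tends
to 0 as n grows. *)
Lemma moment_comparison (L1 L2 : (R -> R) -> R) (c1 c2 : R) :
  positive_functional L1 -> positive_functional L2 ->
  (forall n, L1 (fun x => x ^+ n) = L2 (fun x => x ^+ n)) ->
  c2 < c1 -> L1 (\1_[set x | c1 <= x]) <= L2 (\1_[set x | c2 < x]).
Proof.
move=> pL1 pL2 Lmom c21.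
have [[L1l L1m] [L2l L2m]] := (pL1, pL2).
pose c := (c1 + c2) / 2; pose e := (c1 - c2) / 2.
have e0 : 0 < e by rewrite divr_gt0// subr_gt0.
have c1E : c1 = c + e by rewrite /c /e; field.
have c2E : c2 = c - e by rewrite /c /e; field.
clearbody c e.
have bI (A : set R) : measurable A -> bounded_measurable (\1_A : R -> R).
  move=> mA; split; first exact: measurable_indic.
  by exists 1 => x _; rewrite indicE normr_nat lern1; case: (_ \in _).
have b1 : bounded_measurable (fun=> 1 : R).
  by split => //; exists 1 => x _; rewrite normr1.
have m1 : measurable [set x : R | c1 <= x].
  by rewrite -set_itvcy; exact: measurable_itv.
have m2 : measurable [set x : R | c2 < x].
  by rewrite -set_itvoy; exact: measurable_itv.
(* [B n] at x is the probability of at least n c heads in n tosses of bias x. *)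
pose B n : {poly R} := bernstein n (fun k => (n%:R * c <= k%:R)%R%:R).
have cheb n x : (0 < n)%N -> 0 <= x <= 1 ->
    ((c1 <= x)%R%:R <= 1 / (n%:R * e ^+ 2) * 1 + (B n).[x]) /\
    ((B n).[x] <= 1 / (n%:R * e ^+ 2) * 1 + (c2 < x)%R%:R).
  move=> n0 x01; have /andP[x0 x1] := x01.
  have n0' : 0 < n%:R :> R by rewrite ltr0n.
  have ne0 : 0 < n%:R * e by rewrite mulr_gt0.
  pose V := (bernstein n (fun k => (k%:R - n%:R * x) ^+ 2)).[x].
  have VE : V / (n%:R * e) ^+ 2 <= 1 / (n%:R * e ^+ 2).
    rewrite /V bernstein_variance subrr expr0n addr0.
    have -> : n%:R * (x * (1 - x)) / (n%:R * e) ^+ 2 =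
        (x * (1 - x)) * (1 / (n%:R * e ^+ 2)).
      by field; rewrite !gt_eqF.
    have : 0 <= 1 / (n%:R * e ^+ 2) by apply: divr_ge0 => //; apply: mulr_ge0 => //; exact: sqr_ge0.
    by move=> /ler_piMl; apply; rewrite mulr_ile1 ?subr_ge0// lerBlDr lerDl.
  (* Pointwise form of the Chebyshev inequality: where the number of heads is
     at distance at least n e from n x, the rescaled square is at least 1. *)
  have far (d : R) : n%:R * e <= `|d| -> 1 <= (n%:R * e) ^- 2 * d ^+ 2.
    move=> h; rewrite mulrC ler_pdivlMr ?exprn_gt0// mul1r.
    by rewrite -[d ^+ 2]real_normK ?num_real// lerXn2r ?nnegrE// ltW.
  have V0 : 0 <= V / (n%:R * e) ^+ 2.
    rewrite mulr_ge0 ?invr_ge0 ?sqr_ge0// -(bernstein_cst n 0 x).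
    by apply: bernstein_le => // k; exact: sqr_ge0.
  have B0 : 0 <= (B n).[x].
    by rewrite -(bernstein_cst n 0 x); apply: bernstein_le.
  have B1 : (B n).[x] <= 1.
    rewrite -(bernstein_cst n 1 x); apply: bernstein_le => // k.
    by rewrite lern1; case: leP.
  have q0 := le_trans V0 VE.
  split.
    have [c1x|_] := leP c1 x; last by rewrite addr_ge0// mulr1.
    rewrite mulr1; apply: le_trans (lerD VE (lexx _)).
    rewrite -{1}(bernstein_cst n 1 x) mulrC -[(B n).[x]]mul1r -bernstein_linear.
    apply: bernstein_le => // k; rewrite mul1r.
    have sq0 : 0 <= (n%:R * e) ^- 2 * (k%:R - n%:R * x) ^+ 2.
      by rewrite mulr_ge0 ?sqr_ge0// invr_ge0 sqr_ge0.
    have [ck|ck] := leP (n%:R * c) k%:R; first by rewrite lerDr.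
    rewrite addr0; apply: far; rewrite distrC ger0_norm; nra.
  have [c2x|xc2] := ltP c2 x.
    by rewrite -[leLHS]add0r lerD// mulr1.
  rewrite addr0 mulr1; apply: le_trans VE.
  rewrite mulrC -[leRHS]addr0 -[0](mul0r (bernstein n (fun=> 0)).[x]) -bernstein_linear.
  apply: bernstein_le => // k; rewrite mul0r addr0.
  have [ck|ck] := leP (n%:R * c) k%:R; last by rewrite mulr_ge0 ?sqr_ge0// invr_ge0 sqr_ge0.
  apply: far; rewrite ger0_norm; nra.
have step n : (0 < n)%N -> L1 (\1_[set x | c1 <= x]) <=
    L2 (\1_[set x | c2 < x]) + (L1 (fun=> 1) + L2 (fun=> 1)) / (n%:R * e ^+ 2).
  move=> n0; set q := 1 / (n%:R * e ^+ 2).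
  have bB := bounded_measurable_horner (B n).
  have bqB (psi : R -> R) : bounded_measurable psi ->
      bounded_measurable (fun x => q * 1 + psi x).
    move=> [mpsi [M psiM]]; split; first exact: measurable_funD.
    exists (`|q * 1| + M) => x x01; rewrite (le_trans (ler_normD _ _))//.
    by rewrite lerD2l psiM.
  have h1 : L1 (\1_[set x | c1 <= x]) <= q * L1 (fun=> 1) + L1 (fun x => (B n).[x]).
    rewrite -L1l//; apply: L1m; [exact: bI|exact: bqB|].
    by move=> x x01; have [+ _] := cheb n x n0 x01; rewrite indicE mem_setE.
  have h2 : L2 (fun x => (B n).[x]) <= q * L2 (fun=> 1) + L2 (\1_[set x | c2 < x]).
    rewrite -L2l//; last exact: bI.
    apply: L2m; [by []|exact/bqB/bI|].
    by move=> x x01; have [_] := cheb n x n0 x01; rewrite indicE mem_setE.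
  rewrite (positive_functional_horner (B n) pL1 pL2 Lmom) in h1.
  rewrite [_ / (n%:R * _)](_ : _ = q * L1 (fun=> 1) + q * L2 (fun=> 1)); last first.
    by rewrite /q; ring.
  lra.
apply/ler_addgt0Pr => z z0.
pose M := L1 (fun=> 1) + L2 (fun=> 1).
pose n := (Num.trunc (`|M| / (e ^+ 2 * z))).+1.
apply: (le_trans (step n _)) => //; rewrite lerD2l.
have ez : 0 < e ^+ 2 * z by rewrite mulr_gt0 ?exprn_gt0.
rewrite ler_pdivrMr ?mulr_gt0 ?ltr0n ?exprn_gt0//.
have : `|M| / (e ^+ 2 * z) < n%:R by rewrite /n truncnS_gt.
rewrite ltr_pdivrMr// => /ltW h.
rewrite (le_trans (ler_norm _))// (le_trans h)//.
by rewrite le_eqVlt; apply/orP; left; apply/eqP; ring.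
Qed.

End MomentComparison.

(** * The Gamma function and the Gamma law *)

Section GammaIntegral.
Context (R : realType).
Local Notation mu := (@lebesgue_measure R).

Definition gamma_density (s t : R) : R := t `^ (s - 1) * expR (- t).

Lemma gamma_density_ge0 s t : 0 <= gamma_density s t.
Proof. by rewrite mulr_ge0 ?powR_ge0 ?expR_ge0. Qed.

Lemma measurable_gamma_density s : measurable_fun setT (gamma_density s).
Proof.
apply: measurable_funM; first exact: measurable_powR.
by apply: measurableT_comp => //; exact: measurableT_comp.
Qed.

(** The antiderivative t^s / s is differentiable only for t > 0, whence the lower
end e > 0. *)
Lemma integral_powR_ge (s e : R) : 0 < s -> 0 < e < 1 ->
  (\int[mu]_(t in `[e, 1%R]) (t `^ (s - 1))%:E <= (s^-1)%:E)%E.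
Proof.
move=> s0 /andP[e0 e1].
have dF (x : R) : 0 < x ->
    is_derive x 1 (fun t : R => s^-1 * t `^ s) (x `^ (s - 1)).
  move=> x0; have h := @is_derive1_powR R s x x0.
  have := @is_deriveZ R R^o R^o (fun t : R => t `^ s) s^-1 x 1 _ h.
  by rewrite /GRing.scale/= mulKf// gt_eqF.
have cpow a (x : R) : 0 < x -> {for x, continuous (fun t : R => t `^ a)}.
  move=> x0; apply: differentiable_continuous; apply/derivable1_diffP.
  by apply: derivable_powR; rewrite in_itv/= x0.
rewrite (@continuous_FTC2 _ _ (fun t : R => s^-1 * t `^ s))//.
- rewrite -EFinB lee_fin powR1 mulr1 gerDl oppr_le0.
  by rewrite mulr_ge0 ?powR_ge0// invr_ge0 ltW.
- apply: continuous_in_subspaceT => x; rewrite inE/= in_itv/= => /andP[ex _].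
  by apply: cpow; exact: lt_le_trans ex.
- have cF (x : R) : 0 < x -> {for x, continuous (fun t : R => s^-1 * t `^ s)}.
    move=> x0; apply: differentiable_continuous; apply/derivable1_diffP.
    by apply: ex_derive; exact: dF.
  split.
  + move=> x; rewrite in_itv/= => /andP[ex _]; have := dF _ (lt_trans e0 ex).
    by move=> h; apply: ex_derive.
  + by apply: cvg_at_right_filter; exact: cF.
  + by apply: cvg_at_left_filter; exact: cF.
- move=> x; rewrite in_itv/= => /andP[ex _]; rewrite derive1E.
  by have h := dF _ (lt_trans e0 ex); rewrite derive_val.
Qed.

Lemma integral_powR01 (s : R) : 0 < s ->
  (\int[mu]_(t in `[0%R, 1%R]) (t `^ (s - 1))%:E <= (s^-1)%:E)%E.
Proof.
move=> s0.
have mp D : measurable_fun D (fun t : R => (t `^ (s - 1))%:E).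
  by apply/measurable_EFinP; apply: measurable_funTS; exact: measurable_powR.
rewrite -integral_itv_obnd_cbnd//.
pose F n : set R := [set` `[n.+2%:R^-1, 1]].
have -> : [set` `]0, 1]] = \bigcup_n F n.
  apply/seteqP; split => x /=.
    rewrite in_itv/= => /andP[x0 x1].
    exists (Num.trunc x^-1) => //; rewrite /F/= in_itv/= x1 andbT.
    rewrite invf_ple ?posrE ?ltr0n// ltW// (lt_trans (truncnS_gt _))//.
    by rewrite ltr_nat.
  move=> [n _]; rewrite /F/= !in_itv/= => /andP[nx ->].
  by rewrite (lt_le_trans _ nx)// invr_gt0 ltr0n.
have cvgF : (\int[mu]_(t in F n) (t `^ (s - 1))%:E @[n --> \oo] -->
    \int[mu]_(t in \bigcup_n F n) (t `^ (s - 1))%:E)%E.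
  apply: ge0_nondecreasing_set_cvg_integral => //.
  - apply/nondecreasing_seqP => n; apply/subsetPset => x.
    rewrite /F/= !in_itv/= => /andP[nx ->]; rewrite andbT (le_trans _ nx)//.
    by rewrite lef_pV2 ?posrE ?ltr0n// ler_nat.
  - by move=> n; exact: measurable_itv.
  - by move=> n; exact: mp.
  - by move=> n x _; rewrite lee_fin powR_ge0.
rewrite -(cvg_lim _ cvgF)//; apply: lime_le; first exact: cvgP cvgF.
apply: nearW => n; apply: integral_powR_ge => //.
by rewrite invr_gt0 ltr0n/= invf_lt1 ?ltr0n// ltr1n.
Qed.

(** The density is at most t^(s - 1) on [0, 1], and at most a multiple of
exp(- t / 2) for t > 1, since (t / 2)^(n+1) <= (n+1)! exp(t / 2) for the integer
part n of s. *)
Lemma integral_gamma_density_lty (s : R) : 0 < s ->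
  (\int[mu]_(t in `[0%R, +oo[) (gamma_density s t)%:E < +oo)%E.
Proof.
move=> s0.
pose n := Num.trunc s.
pose C : R := n.+1`!%:R * 2 ^+ n.+1 * 2.
have C0 : 0 <= C by rewrite !mulr_ge0.
have bound t : 0 <= t -> gamma_density s t <=
    (\1_`[0, 1] t) * t `^ (s - 1) + C * exponential_pdf (2^-1) t.
  move=> t0; have [t1|t1] := leP t 1.
    rewrite indicE mem_set/= ?in_itv/= ?t0 ?t1// mul1r.
    rewrite -[leLHS]addr0 lerD//; last by rewrite mulr_ge0 ?exponential_pdf_ge0.
    by rewrite ler_piMr ?powR_ge0// -expR0 ler_expR oppr_le0.
  rewrite indicE memNset/= ?in_itv/= ?t0 ?(lt_geF t1)// mul0r add0r.
  rewrite exponential_pdfE//.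
  have -> : C * (2^-1 * expR (- 2^-1 * t)) = (C / 2) * expR (- (t / 2)).
    by rewrite mulrA mulNr [2^-1 * t]mulrC.
  rewrite /gamma_density (_ : - t = - (t / 2) + - (t / 2)); last by field.
  rewrite expRD mulrA ler_wpM2r ?expR_ge0//.
  rewrite expRN -ler_pdivlMr ?invr_gt0 ?expR_gt0// invrK /C mulfK//.
  have := expR_ge1Dxn n (divr_ge0 t0 (ler0n _ 2)).
  move=> /(le_trans (ler_wpDl _ (lexx _)))=> /(_ ler01).
  rewrite ler_pdivrMr ?ltr0n ?fact_gt0// expr_div_n ler_pdivrMr ?exprn_gt0//.
  move=> h; apply: le_trans (le_trans _ h) _; last first.
    by rewrite -mulrA mulrC.
  rewrite -powR_mulrn//; apply: ler_powR; first exact: ltW.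
  by rewrite lerBlDr (le_trans (ltW (truncnS_gt _)))// -natr1 lerDl.
have m01 : measurable_fun setT (fun t : R => \1_`[0, 1] t * t `^ (s - 1)).
  by apply: measurable_funM => //; exact: measurable_powR.
have mE := measurable_exponential_pdf (2^-1 : R).
apply: (@le_lt_trans _ _ (\int[mu]_t
   ((\1_`[0, 1] t * t `^ (s - 1))%:E + C%:E * (exponential_pdf (2^-1) t)%:E))%E).
  rewrite integral_mkcond; apply: ge0_le_integral => //.
  - by move=> t _; apply: erestrict_ge0 => {}t _; rewrite lee_fin gamma_density_ge0.
  - apply: (measurable_restrictT (EFin \o gamma_density s) _).1 => //.
    apply/measurable_EFinP; apply: measurable_funTS.
    exact: measurable_gamma_density.
  - by apply/measurable_EFinP; apply: measurable_funD => //; exact: measurable_funM.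
  - move=> t _; rewrite -EFinM -EFinD patchE; case: ifPn => [|_].
      by rewrite inE/= in_itv/= andbT => t0; rewrite lee_fin bound.
    rewrite lee_fin addr_ge0//; apply: mulr_ge0 => //.
    - exact: powR_ge0.
    - exact: exponential_pdf_ge0.
rewrite ge0_integralD//; last 4 first.
- by move=> t _; rewrite lee_fin mulr_ge0 ?powR_ge0// indicE.
- exact/measurable_EFinP.
- by move=> t _; rewrite mule_ge0 ?lee_fin ?exponential_pdf_ge0.
- by apply/measurable_EFinP; exact: measurable_funM.
apply: lte_add_pinfty.
  rewrite (_ : \int[mu]_t _ = \int[mu]_(t in `[0%R, 1%R]) (t `^ (s - 1))%:E)%E.
    by rewrite (le_lt_trans (integral_powR01 s0))// ltry.
  rewrite [RHS]integral_mkcond; apply: eq_integral => t _.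
  by rewrite epatch_indic muleC EFinM.
rewrite ge0_integralZl_fin//; last by move=> t; exact: exponential_pdf_ge0.
by rewrite integral_exponential_pdf ?mule1 ?ltry.
Qed.

End GammaIntegral.

Section GammaLaw.
Context (R : realType).
Local Notation mu := (@lebesgue_measure R).

Lemma ge0_integral_scale (c : R) (f : R -> \bar R) : 0 < c ->
  measurable_fun setT f -> (forall t, 0 <= f t)%E ->
  (\int[mu]_t f (c * t)%R * c%:E = \int[mu]_t f t)%E.
Proof.
move=> c0 mf f0.
have mX : measurable_fun (setT : set (measurableTypeR R))
    ((fun t : R => c * t) : _ -> measurableTypeR R) by exact: measurable_funM.
pose nu := mscale (NngNum (ltW c0))
  (measure_function_pushforward__canonical__measure_function_Measure mu mX).
have nuE A : measurable A -> mu A = nu A.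
  move: A; apply: (@lebesgue_measure_unique R nu) => _ [[a b] _ <-] /=.
  rewrite /nu /mscale/= /pushforward/=.
  rewrite (_ : _ @^-1` _ = [set` `]a / c, b / c]]); last first.
    apply/seteqP; split => t; rewrite /= !in_itv/=;
      by rewrite ltr_pdivrMr// ler_pdivlMr// mulrC.
  rewrite !lebesgue_measure_itv/= !lte_fin ltr_pM2r ?invr_gt0//.
  case: ifP => _; last by rewrite mule0.
  by rewrite -!EFinB -EFinM -mulrBl mulrCA divff ?mulr1// gt_eqF.
transitivity (\int[mu]_t (f (c * t)%R * c%:E))%E.
  rewrite ge0_integralZr ?lee_fin ?ltW//.
  by apply: (measurableT_comp mf); exact: measurable_funM.
apply: (@ge0_integral_density _ _ (measurableTypeR R) (measurableTypeR R) R mu mu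
  (fun t : R => c * t) (cst c) f) => //.
- by move=> t; exact: ltW c0.
- move=> B mB; rewrite [RHS]nuE// /nu /mscale/= /pushforward/=.
  have mXB := mX measurableT _ mB; rewrite setTI in mXB.
  exact: (integral_cst mu mXB c%:E).
Qed.

(** Substitution of c t for t. The integral on the right is Gamma(s), kept as an
extended real so that no finiteness is presupposed. *)
Lemma gamma_laplace (s c : R) : 0 < c ->
  (\int[mu]_(t in `[0%R, +oo[) (t `^ (s - 1) * expR (- (c * t)))%:E =
   (c `^ (- s))%:E * \int[mu]_(t in `[0%R, +oo[) (gamma_density s t)%:E)%E.
Proof.
move=> c0; rewrite [X in (_ * X)%E]integral_mkcond.
set f := _ \_ _.
have mf : measurable_fun setT f.
  apply: (measurable_restrictT (EFin \o gamma_density s) _).1 => //.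
  apply/measurable_EFinP; apply: measurable_funTS.
  exact: measurable_gamma_density.
have f0 t : (0 <= f t)%E.
  by apply: erestrict_ge0 => {}t _; rewrite lee_fin gamma_density_ge0.
rewrite -(ge0_integral_scale c0)//.
rewrite [RHS]muleCA -EFinM.
have -> : c `^ (- s) * c = c `^ (1 - s).
  rewrite mulrC -{1}(powRr1 (ltW c0)) -powRD//.
  by apply/implyP => _; rewrite gt_eqF.
rewrite [RHS]muleC -ge0_integralZl ?lee_fin ?powR_ge0//; last first.
  by apply: (measurableT_comp mf); exact: measurable_funM.
rewrite [LHS]integral_mkcond; apply: eq_integral => t _; rewrite /f !patchE.
have -> : (c * t \in `[0, +oo[%classic) = (t \in `[0, +oo[%classic).
  by apply/idP/idP; rewrite !inE/= !in_itv/= !andbT pmulr_rge0.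
case: ifPn => [|_]; last by rewrite mule0.
rewrite inE/= in_itv/= andbT => t0.
rewrite /= -EFinM /gamma_density; congr EFin; rewrite [RHS]mulrA; congr (_ * _).
rewrite (powRM _ (ltW c0) t0) mulrA -powRD; last first.
  by apply/implyP => _; rewrite gt_eqF.
by rewrite addrA subrK subrr powRr0 mul1r.
Qed.

Lemma integral_gamma_density_gt0 (s : R) : 0 < s ->
  (0 < \int[mu]_(t in `[0%R, +oo[) (gamma_density s t)%:E)%E.
Proof.
move=> s0.
have e0 : 0 < expR (- 2) / 2 :> R by rewrite divr_gt0 ?expR_gt0.
apply: (@lt_le_trans _ _ (\int[mu]_(t in `[1%R, 2%R]) (expR (- 2) / 2)%:E)%E).
  rewrite integral_cst//= lebesgue_measure_itv/= lte_fin ltr1n.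
  by rewrite -EFinB -EFinM lte_fin mulr_gt0// subr_gt0 ltr1n.
have mg (D : set R) : measurable_fun D (EFin \o gamma_density s).
  apply/measurable_EFinP; apply: measurable_funTS.
  exact: measurable_gamma_density.
apply: (@le_trans _ _ (\int[mu]_(t in `[1%R, 2%R]) (gamma_density s t)%:E)%E).
  apply: ge0_le_integral => //.
  - exact: mg.
  move=> t; rewrite /= in_itv/= => /andP[t1 t2]; rewrite lee_fin.
  have t0 : 0 < t by exact: lt_le_trans t1.
  rewrite /gamma_density mulrC ler_pM ?expR_ge0 ?invr_ge0//.
  - apply: (@le_trans _ _ (t `^ (- 1))).
      by rewrite powRN (powRr1 (ltW t0)) lef_pV2 ?posrE.
    by apply: ler_powR => //; lra.
  - by rewrite ler_expR lerN2.
apply: ge0_subset_integral => //; first exact: mg.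
  by move=> t _; rewrite lee_fin gamma_density_ge0.
by move=> t /=; rewrite !in_itv/= => /andP[t1 _]; rewrite andbT (le_trans _ t1).
Qed.

Lemma GammaE (s : R) : 0 < s ->
  (\int[mu]_(t in `[0%R, +oo[) (gamma_density s t)%:E = (Gamma s)%:E)%E.
Proof.
move=> s0; rewrite /Gamma /Rintegral fineK//.
by rewrite ge0_fin_numE ?integral_gamma_density_lty// ltW// integral_gamma_density_gt0.
Qed.

Lemma Gamma_gt0 (s : R) : 0 < s -> 0 < Gamma s.
Proof. by move=> s0; rewrite -lte_fin -GammaE// integral_gamma_density_gt0. Qed.

End GammaLaw.

Lemma measurable_sublevel d (T : measurableType d) (R : realType) (X : T -> R)
    (q : R) : measurable_fun setT X -> measurable [set t | X t <= q].
Proof.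
move=> mX.
rewrite [X in measurable X](_ : _ = setT `&` X @^-1` ([set` `]-oo, q]] : set R)).
  by apply: mX => //; exact: measurable_itv.
by rewrite setTI; apply/seteqP; split => t /=; rewrite in_itv.
Qed.
Section GammaComparison.
Context (R : realType).
Local Notation mu := (@lebesgue_measure R).

Lemma integrable_gamma_density (s : R) (D : set R) : 0 < s -> measurable D ->
  D `<=` `[0, +oo[ -> mu.-integrable D (EFin \o gamma_density s).
Proof.
move=> s0 mD D0; apply: (@integrableS _ _ _ mu ([set` `[0%R, +oo[] : set R)) => //.
have mg : measurable_fun ([set` `[0%R, +oo[] : set R) (EFin \o gamma_density s).
  apply/measurable_EFinP; apply: measurable_funTS.
  exact: measurable_gamma_density.
apply/integrableP; split => //.
under eq_integral do rewrite /= ger0_norm ?gamma_density_ge0//.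
exact: integral_gamma_density_lty.
Qed.

(** A bound on the derivative t^(s - 1) exp(- t): on [x, x + 1] the power t^(s - 1)
is monotone, in a direction that depends on the sign of s - 1, so the sum of its
values at the two ends dominates it in both cases. *)
Lemma lower_gamma_le (s x y : R) : 0 < s -> 0 < x -> x <= y -> y <= x + 1 ->
  lower_gamma s y <=
  lower_gamma s x + (x `^ (s - 1) + (x + 1) `^ (s - 1)) * (y - x).
Proof.
move=> s0 x0 xy y1.
have x0' := ltW x0.
have ig (D : set R) : measurable D -> D `<=` `[0, +oo[ ->
    mu.-integrable D (EFin \o gamma_density s) := integrable_gamma_density s0.
rewrite /lower_gamma -/(gamma_density s).
rewrite addrC -lerBlDr.
rewrite Rintegral_itvB ?bnd_simp//; last first.
  by apply: ig => // t; rewrite /= !in_itv/= andbT => /andP[].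
set M := _ + _ `^ _.
have -> : M * (y - x) = \int[mu]_(t in `]x, y]) M.
  rewrite Rintegral_cst//= lebesgue_measure_itv/=; case: ifPn => [_//|].
  by rewrite lte_fin -leNgt => yx; rewrite (_ : y = x) ?subrr//; apply/le_anti/andP.
have sub0 : [set` `]x, y]] `<=` `[0, +oo[.
  move=> t; rewrite /= !in_itv/= andbT => /andP[xt _].
  exact: le_trans x0' (ltW xt).
apply: le_Rintegral => //.
- exact: ig.
- apply: measurable_bounded_integrable => //=.
    by rewrite lebesgue_measure_itv/=; case: ifP => _; rewrite ?ltry// -EFinB ltry.
  by exists `|M|; split; [exact: normr_real|move=> r Mr t _ /=; exact: ltW].
- move=> t /=; rewrite in_itv/= => /andP[xt ty].
  have t0 : 0 < t by exact: lt_trans xt.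
  rewrite /gamma_density (@le_trans _ _ (t `^ (s - 1)))//.
    by rewrite ler_piMr ?powR_ge0// -expR0 ler_expR oppr_le0 ltW.
  have [s1|s1] := leP 0 (s - 1).
    rewrite (@le_trans _ _ ((x + 1) `^ (s - 1)))//; last by rewrite lerDr powR_ge0.
    apply: ge0_ler_powR => //; rewrite ?nnegrE ?addr_ge0//; first exact: ltW.
    exact: le_trans y1.
  rewrite (@le_trans _ _ (x `^ (s - 1)))//; last by rewrite lerDl powR_ge0.
  rewrite -[s - 1]opprK !(powRN _ (- (s - 1))) lef_pV2 ?posrE ?powR_gt0//.
  apply: ge0_ler_powR; rewrite ?nnegrE ?oppr_ge0//; exact: ltW.
Qed.

(** The hypothesis says that Y has the Laplace transform of the Gamma law at the
integers, that is, exp(- Y) has the moments of exp(- t) for t distributed with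
the Gamma density. [moment_comparison] then bounds P[Y <= x] by the Gamma
distribution function at any y > x, and this function is locally Lipschitz by
[lower_gamma_le]. *)
Lemma gamma_law_lower_tail d (T : measurableType d) (P : probability T R)
    (Y : T -> R) (s x : R) :
  measurable_fun setT Y -> (forall t, 0 <= Y t) -> 0 < s -> 0 < x ->
  (forall n : nat, \int[P]_t (expR (- (n%:R * Y t)))%:E =
    ((1 + n%:R) `^ (- s))%:E)%E ->
  (P [set t | (Y t <= x)%R] <= ((Gamma s)^-1 * lower_gamma s x)%:E)%E.
Proof.
move=> mY Y0 s0 x0 laplaceY.
have G0 := Gamma_gt0 s0.
have mP y : measurable [set t | Y t <= y] by exact: measurable_sublevel.
pose g (t : R) := (Gamma s)^-1 * (gamma_density s \_ ([set` `[0%R, +oo[] : set R)) t.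
have g0 t : 0 <= g t.
  apply: mulr_ge0; rewrite ?invr_ge0 ?(ltW G0)// patchE.
  by case: ifP => // _; exact: gamma_density_ge0.
have ig : mu.-integrable setT (EFin \o g).
  have : mu.-integrable setT (EFin \o (gamma_density s \_ ([set` `[0%R, +oo[] : set R))).
    rewrite -restrict_EFin; apply/integrable_restrict => //.
    by rewrite setTI; exact: integrable_gamma_density.
  move=> /(integrableZl measurableT (Gamma s)^-1); apply: eq_integrable => //.
pose U t := expR (- Y t).
(* The absolute value keeps V in [0, 1] where the density vanishes. *)
pose V (t : R) := expR (- `|t|).
have mU : measurable_fun setT U by apply: measurableT_comp => //; exact: measurableT_comp.
have mV : measurable_fun setT V.
  apply: (measurableT_comp (@measurable_expR R)).
  exact: (measurableT_comp (@oppr_measurable R setT) (@normr_measurable R setT)).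
have exp01 (y : R) : 0 <= y -> 0 <= expR (- y) <= 1.
  by move=> y0; rewrite expR_ge0/= -expR0 ler_expR oppr_le0.
have U01 t : 0 <= U t <= 1 by exact: exp01.
have V01 t : 0 <= V t <= 1 by exact: exp01.
have i1 : P.-integrable setT (EFin \o (fun=> 1 : R)).
  exact: (finite_measure_integrable_cst P 1 measurableT).
have pU := positive_functional_integral mU U01 (fun=> ler01) i1.
have pV := @positive_functional_integral R _ (measurableTypeR R) mu V g mV V01 g0 ig.
have moments n : \int[P]_t (U t ^+ n * 1) = \int[mu]_t (V t ^+ n * g t).
  have -> : \int[P]_t (U t ^+ n * 1) = (1 + n%:R) `^ (- s).
    rewrite -[RHS]/(fine ((1 + n%:R) `^ (- s))%:E) -laplaceY.
    congr fine; apply: eq_integral => t _; congr EFin.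
    by rewrite mulr1 /U -expRM_natl mulrN.
  have c0 : 0 < 1 + n%:R :> R by rewrite ltr_wpDr.
  have := gamma_laplace s c0; rewrite GammaE// => laplaceG.
  transitivity (fine ((Gamma s)^-1%:E * \int[mu]_(t in `[0%R, +oo[)
      (t `^ (s - 1) * expR (- ((1 + n%:R) * t)))%:E)%E).
    by rewrite laplaceG -!EFinM/= mulrCA mulVf ?mulr1// gt_eqF.
  congr fine; rewrite [in LHS]integral_mkcond -ge0_integralZl//; last 3 first.
  - apply: (measurable_restrictT (EFin \o (fun t => t `^ (s - 1) *
      expR (- ((1 + n%:R) * t)))) _).1 => //.
    apply/measurable_EFinP; apply: measurable_funTS.
    apply: measurable_funM; first exact: measurable_powR.
    apply: (measurableT_comp (@measurable_expR R)).
    apply: (measurableT_comp (@oppr_measurable R setT)).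
    exact: measurable_funM.
  - move=> t _; apply: erestrict_ge0 => {}t _.
    by rewrite lee_fin mulr_ge0 ?powR_ge0 ?expR_ge0.
  - by rewrite lee_fin invr_ge0 (ltW G0).
  apply: eq_integral => t _; rewrite /g !patchE.
  case: ifPn => [|_]; last by rewrite !mulr0 mule0.
  rewrite inE/= in_itv/= andbT => t0; rewrite -EFinM; congr EFin.
  rewrite [RHS]mulrCA; congr (_ * _).
  rewrite /gamma_density [RHS]mulrCA; congr (_ * _).
  by rewrite /V ger0_norm// -expRM_natl -expRD; congr expR; ring.
have le_y y : x < y -> fine (P [set t | Y t <= x]) <= (Gamma s)^-1 * lower_gamma s y.
  move=> xy; have y0 := lt_trans x0 xy.
  have cc : expR (- y) < expR (- x) by rewrite ltr_expR ltrN2.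
  have := moment_comparison pU pV moments cc.
  rewrite [X in X <= _ -> _](_ : _ = fine (P [set t | Y t <= x])); last first.
    congr fine; rewrite -[X in P X]setIT -integral_indic//.
    apply: eq_integral => t _; rewrite mulr1 !indicE; congr (_%:R)%:E.
    by congr nat_of_bool; apply/idP/idP; rewrite !inE/= /U ler_expR lerN2.
  move=> /le_trans; apply.
  rewrite /lower_gamma -/(gamma_density s).
  have iy : mu.-integrable ([set` `[0%R, y]] : set R) (EFin \o gamma_density s).
    apply: integrable_gamma_density => // t /=; rewrite !in_itv/= andbT.
    by move=> /andP[].
  rewrite -[leRHS]RintegralZl// [leRHS]Rintegral_mkcond.
  have iR : mu.-integrable setT (EFin \o
      ((fun t => (Gamma s)^-1 * gamma_density s t) \_ ([set` `[0%R, y]] : set R))).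
    rewrite -restrict_EFin; apply/integrable_restrict => //; rewrite setTI.
    have my : measurable ([set` `[0%R, y]] : set (measurableTypeR R)).
      exact: measurable_itv.
    by have := integrableZl my (Gamma s)^-1 iy; apply: eq_integrable.
  apply: le_Rintegral => //.
    apply: (@integrableMr _ (measurableTypeR R) R mu setT measurableT
      (\1_[set x | expR (- y) < x] \o V) (EFin \o g)) => //.
      apply: measurableT_comp => //; apply: measurable_indic.
      by rewrite -set_itvoy; exact: measurable_itv.
    exists 1; split => // r r1 t _ /=; rewrite indicE normr_nat.
    by rewrite (le_trans _ (ltW r1))// lern1; case: (_ \in _).
  move=> t _; rewrite /g !patchE.
  have [t0|t0] := boolP (t \in ([set` `[0%R, +oo[] : set R)); last first.
    rewrite mulr0 mulr0; case: ifP => // _.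
    by rewrite mulr_ge0 ?gamma_density_ge0// invr_ge0 (ltW G0).
  move: t0; rewrite inE/= in_itv/= andbT => t0.
  have [ty|ty] := ltP t y.
    rewrite mem_set/= ?in_itv/= ?t0 ?(ltW ty)// indicE.
    rewrite ler_piMl ?lern1 ?leq_b1//.
    by rewrite mulr_ge0 ?gamma_density_ge0// invr_ge0 (ltW G0).
  rewrite indicE memNset ?mul0r; last first.
    by rewrite /= /V ger0_norm// ltr_expR ltrN2 ltNge ty.
  by case: ifP => // _; rewrite mulr_ge0 ?gamma_density_ge0// invr_ge0 (ltW G0).
rewrite -[leLHS]fineK ?fin_num_measure// lee_fin.
apply/ler_addgt0Pr => e e0.
pose M := x `^ (s - 1) + (x + 1) `^ (s - 1).
have M0 : 0 < M by rewrite addr_gt0 ?powR_gt0// addr_gt0.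
pose h := Num.min 1 (e * Gamma s / M).
have h0 : 0 < h by rewrite lt_min ltr01/= divr_gt0 ?mulr_gt0.
apply: (le_trans (le_y (x + h) _)); first by rewrite ltrDl.
rewrite -[e](mulKf (lt0r_neq0 G0)) -mulrDr ler_wpM2l ?invr_ge0 ?(ltW G0)//.
apply: (le_trans (lower_gamma_le s0 x0 _ _)).
- by rewrite lerDl ltW.
- by rewrite lerD2l /h ge_min lexx.
rewrite lerD2l -/M [x + h]addrC addrK mulrC -ler_pdivlMr//.
by rewrite [Gamma s * e]mulrC /h ge_min lexx orbT.
Qed.

End GammaComparison.

(** * Real and complex scalars *)

Section ScalarTheory.
Context (R : realType) (k : scalars).
Local Notation K := (Kfield R k).
Implicit Types x y : K.

Lemma Kext x y : Kre x = Kre y -> Kim x = Kim y -> x = y.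
Proof. by case: k x y => //= -[a b] [c d] /= -> ->. Qed.

Lemma Kre_conj x : Kre (Kconj x) = Kre x. Proof. by case: k x. Qed.
Lemma Kim_conj x : Kim (Kconj x) = - Kim x.
Proof. by case: k x => //= x; rewrite oppr0. Qed.
Lemma Kre_real a : Kre (Kreal a : K) = a. Proof. by case: k. Qed.
Lemma Kim_real a : Kim (Kreal a : K) = 0. Proof. by case: k. Qed.

Lemma KreB x y : Kre (x - y) = Kre x - Kre y.
Proof. by case: k x y => //= -[a b] [c d]. Qed.
Lemma KimB x y : Kim (x - y) = Kim x - Kim y.
Proof. by case: k x y => //= [x y|[a b] [c d]//]; rewrite subr0. Qed.
Lemma KreM x y : Kre (x * y) = Kre x * Kre y - Kim x * Kim y.
Proof. by case: k x y => //= [x y|[a b] [c d]//]; rewrite mulr0 subr0. Qed.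
Lemma KimM x y : Kim (x * y) = Kre x * Kim y + Kim x * Kre y.
Proof. by case: k x y => //= [x y|[a b] [c d]//]; rewrite !(mulr0, mul0r) addr0. Qed.
Lemma Kre1 : Kre (1 : K) = 1. Proof. by case: k. Qed.
Lemma Kim1 : Kim (1 : K) = 0. Proof. by case: k. Qed.

HB.instance Definition _ :=
  GRing.isZmodMorphism.Build K R (@Kre R k) KreB.
HB.instance Definition _ :=
  GRing.isZmodMorphism.Build K R (@Kim R k) KimB.

Lemma Kre0 : Kre (0 : K) = 0. Proof. exact: raddf0. Qed.
Lemma Kim0 : Kim (0 : K) = 0. Proof. exact: raddf0. Qed.
Lemma KreD x y : Kre (x + y) = Kre x + Kre y. Proof. exact: raddfD. Qed.
Lemma KimD x y : Kim (x + y) = Kim x + Kim y. Proof. exact: raddfD. Qed.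
Lemma KreN x : Kre (- x) = - Kre x. Proof. exact: raddfN. Qed.
Lemma KimN x : Kim (- x) = - Kim x. Proof. exact: raddfN. Qed.

(** Identities between scalars over either field are proved by comparing real and
imaginary parts, which this rule expands into polynomials in real variables. *)
Definition KpartsE := (Kre_conj, Kim_conj, Kre_real, Kim_real, KreB, KimB,
  KreD, KimD, Kre0, Kim0, KreN, KimN, KreM, KimM, Kre1, Kim1).

Lemma KconjB : {morph (@Kconj R k) : x y / x - y}.
Proof. by move=> x y; apply: Kext; rewrite !KpartsE ?opprD. Qed.
Lemma KconjM : {morph (@Kconj R k) : x y / x * y}.
Proof. by move=> x y; apply: Kext; rewrite !KpartsE; ring. Qed.
Lemma Kconj1 : Kconj (1 : K) = 1.
Proof. by apply: Kext; rewrite !KpartsE ?oppr0. Qed.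

HB.instance Definition _ :=
  GRing.isZmodMorphism.Build K K (@Kconj R k) KconjB.
HB.instance Definition _ :=
  GRing.isMonoidMorphism.Build K K (@Kconj R k) (Kconj1, KconjM).

Lemma KrealB : {morph (@Kreal R k) : a b / a - b}.
Proof. by move=> x y; apply: Kext; rewrite !KpartsE ?subr0. Qed.
Lemma KrealM : {morph (@Kreal R k) : a b / a * b}.
Proof. by move=> x y; apply: Kext; rewrite !KpartsE; ring. Qed.
Lemma Kreal1 : Kreal 1 = 1 :> K.
Proof. by apply: Kext; rewrite !KpartsE. Qed.

HB.instance Definition _ :=
  GRing.isZmodMorphism.Build R K (@Kreal R k) KrealB.
HB.instance Definition _ :=
  GRing.isMonoidMorphism.Build R K (@Kreal R k) (Kreal1, KrealM).

Lemma KconjK x : Kconj (Kconj x) = x.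
Proof. by apply: Kext; rewrite !KpartsE ?opprK. Qed.
Lemma Kconj_real a : Kconj (Kreal a : K) = Kreal a.
Proof. by apply: Kext; rewrite !KpartsE ?oppr0. Qed.
Lemma mulKconj x : x * Kconj x = Kreal (Kre x ^+ 2 + Kim x ^+ 2).
Proof. by apply: Kext; rewrite !KpartsE; ring. Qed.

End ScalarTheory.

(** * Hermitian matrices over the scalar field *)

Section Adjoint.
Context (R : realType) (k : scalars).
Local Notation K := (Kfield R k).

Definition adj m n (A : 'M[K]_(m, n)) : 'M[K]_(n, m) := (map_mx Kconj A)^T.

Lemma adjE m n (A : 'M[K]_(m, n)) i j : adj A i j = Kconj (A j i).
Proof. by rewrite !mxE. Qed.

Lemma adjK m n (A : 'M[K]_(m, n)) : adj (adj A) = A.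
Proof. by apply/matrixP => i j; rewrite !adjE KconjK. Qed.

Lemma adjM m n p (A : 'M[K]_(m, n)) (B : 'M[K]_(n, p)) :
  adj (A *m B) = adj B *m adj A.
Proof. by rewrite /adj map_mxM trmx_mul. Qed.

Lemma adj1 n : adj (1%:M : 'M[K]_n) = 1%:M.
Proof. by rewrite /adj map_mx1 trmx1. Qed.

Lemma adjZ m n (a : K) (A : 'M[K]_(m, n)) : adj (a *: A) = Kconj a *: adj A.
Proof. by apply/matrixP => i j; rewrite !mxE rmorphM. Qed.

Lemma mulmx_adj_diag m n (A : 'M[K]_(m, n)) i :
  (A *m adj A) i i = Kreal (\sum_j (Kre (A i j) ^+ 2 + Kim (A i j) ^+ 2)).
Proof.
rewrite mxE raddf_sum/=; apply: eq_bigr => j _.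
by rewrite adjE mulKconj.
Qed.

Lemma sum_parts_eq0 (I : finType) (x : I -> K) :
  \sum_i (Kre (x i) ^+ 2 + Kim (x i) ^+ 2) = 0 -> forall i, x i = 0.
Proof.
move=> x0 i; have nn j : 0 <= Kre (x j) ^+ 2 + Kim (x j) ^+ 2.
  by rewrite addr_ge0 ?sqr_ge0.
have := x0; move/eqP; rewrite psumr_eq0// => /allP/(_ i); rewrite mem_index_enum.
move=> /(_ isT)/=; rewrite paddr_eq0 ?sqr_ge0// !sqrf_eq0 => /andP[/eqP a /eqP b].
by apply: Kext; rewrite ?a ?b !KpartsE.
Qed.

Lemma mulmx_adj_eq0 n (v : 'rV[K]_n) : v *m adj v = 0 -> v = 0.
Proof.
move=> /matrixP/(_ 0 0); rewrite mulmx_adj_diag mxE.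
move=> /(congr1 Kre); rewrite !KpartsE => h.
by apply/matrixP => i j; rewrite ord1 mxE (sum_parts_eq0 h j).
Qed.

(** Evaluating v M v^* with M acting on either side gives both a v v^* and its
conjugate. *)
Lemma hermitian_eigenvalue_real n (M : 'M[K]_n) (v : 'rV[K]_n) (a : K) :
  adj M = M -> v != 0 -> v *m M = a *: v -> a = Kreal (Kre a).
Proof.
move=> hM v0 vM.
have e1 : v *m M *m adj v = a *: (v *m adj v) by rewrite vM scalemxAl.
have e2 : v *m M *m adj v = Kconj a *: (v *m adj v).
  rewrite -mulmxA -{1}hM -adjM vM.
  by rewrite adjZ scalemxAr.
have := mulmx_adj_eq0 (v := v).
have [-> /(_ erefl) v00|/eqP vv0 _] := v *m adj v =P 0.
  by rewrite v00 eqxx in v0.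
have : (a - Kconj a) *: (v *m adj v) == 0 by rewrite scalerBl -e1 -e2 subrr.
rewrite scalemx_eq0 (negbTE vv0) orbF subr_eq0 => /eqP h.
by apply: Kext; rewrite ?KpartsE//; move: (congr1 Kim h); rewrite KpartsE; lra.
Qed.

End Adjoint.

Lemma hermitian_eigenvector_complex (R : realType) n
    (M : 'M[Kfield R ComplexScalars]_n.+1) : adj M = M ->
  exists (a : R) (v : 'rV_n.+1), v != 0 /\ v *m M = Kreal a *: v.
Proof.
move=> hM.
have [a /eigenvalueP[v vM v0]] := @eigenvalue_closed R[i] n.+1 M (ltn0Sn n).
exists (Kre (a : Kfield R ComplexScalars)), v; split => //.
by rewrite -(hermitian_eigenvalue_real hM v0 vM).
Qed.

(** Over the reals, M seen as a complex matrix has an eigenvalue, which is real by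
[hermitian_eigenvalue_real]; it is then a root of the real characteristic
polynomial. *)
Lemma hermitian_eigenvector (R : realType) (k : scalars) n
    (M : 'M[Kfield R k]_n.+1) : adj M = M ->
  exists (a : R) (v : 'rV_n.+1), v != 0 /\ v *m M = Kreal a *: v.
Proof.
case: k M => [M hM|M hM]; last exact: hermitian_eigenvector_complex.
pose Mc : 'M[Kfield R ComplexScalars]_n.+1 := map_mx (real_complex R) M.
have hMc : adj Mc = Mc.
  apply/matrixP => i j; rewrite adjE !mxE/=.
  have := congr1 (fun A : 'M[Kfield R RealScalars]_(n.+1) => A i j) hM; rewrite adjE /= => <-.
  by rewrite /Kconj/= oppr0.
have [a [v [v0 vM]]] := hermitian_eigenvector_complex hMc.
have : eigenvalue (Mc : 'M[R[i]]_n.+1) (real_complex R a).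
  by apply/eigenvalueP; exists v.
rewrite eigenvalue_root_char.
have -> : char_poly (Mc : 'M[R[i]]_n.+1) = map_poly (real_complex R) (char_poly (M : 'M[R]_n.+1)).
  by rewrite map_char_poly.
rewrite fmorph_root -eigenvalue_root_char => /eigenvalueP[w wM w0].
by exists a, w.
Qed.

Section OrthonormalExtension.
Context (R : realType) (k : scalars).
Local Notation K := (Kfield R k).

(** One extension step is assumed, and iterated. The pairing [ip] and the predicate
[Q] are abstract so that the lemma serves both row vectors, to complete a unit
eigenvector to a basis, and functions, to complete the right singular vectors. *)
Lemma extend_orthonormal (E : Type) (ip : E -> E -> K) (Q : E -> Prop)
    (N m : nat) (e0 : nat -> E) :
  (forall v w, Q v -> Q w -> ip w v = 0 -> ip v w = 0) ->
  (forall n e, (n < N)%N -> (forall i, (i < n)%N -> Q (e i)) ->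
    exists w, [/\ Q w, ip w w = 1 & forall i, (i < n)%N -> ip w (e i) = 0]) ->
  (m <= N)%N -> (forall i, (i < m)%N -> Q (e0 i)) ->
  (forall i j, (i < m)%N -> (j < m)%N -> ip (e0 i) (e0 j) = (i == j)%:R) ->
  exists e, [/\ forall i, (i < m)%N -> e i = e0 i,
    forall i, (i < N)%N -> Q (e i) &
    forall i j, (i < N)%N -> (j < N)%N -> ip (e i) (e j) = (i == j)%:R].
Proof.
move=> ipC ext1; move: {-2}N (leqnn N) => p pN.
elim: p pN => [|p IH] pN mp Q0 orth0.
  by exists e0; split=> // i; rewrite (eqP (_ : m == 0%N)) -?leqn0.
move: mp; rewrite leq_eqVlt => /predU1P[mp|mp].
  by exists e0; rewrite -mp; split.
have [e [ee0 Qe orth]] := IH (ltnW pN) mp Q0 orth0.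
have [w [Qw ww we]] := ext1 p e pN Qe.
exists (fun i => if i == p then w else e i); split.
- by move=> i im; rewrite ltn_eqF ?ee0// (leq_trans im).
- move=> i ip1; case: eqP => // /eqP ip0; apply: Qe.
  by rewrite ltn_neqAle ip0 -ltnS.
- move=> i j; rewrite !ltnS => ip1 jp1.
  have lt i' : (i' <= p)%N -> i' != p -> (i' < p)%N.
    by move=> ? ?; rewrite ltn_neqAle; apply/andP.
  case: (i =P p) => [->|/eqP/(lt _ ip1) ip']; case: (j =P p) => [->|/eqP/(lt _ jp1) jp'].
  + by rewrite ww eqxx.
  + by rewrite we// gtn_eqF.
  + by rewrite ltn_eqF// ipC// ?we//; exact: Qe.
  + by rewrite orth.
Qed.

(** The form in which dimension counts are used: among n vectors, some combination
is orthogonal to m < n given ones, G being the matrix of inner products. *)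
Lemma left_kernel_vector m n (G : 'M[K]_(n, m)) : (m < n)%N ->
  exists w : 'rV[K]_n, w != 0 /\ w *m G = 0.
Proof.
move=> mn; exists (nz_row (kermx G)); split.
  rewrite nz_row_eq0 -mxrank_eq0 mxrank_ker subn_eq0 -ltnNge.
  by rewrite (leq_ltn_trans (rank_leq_col _)).
by apply/sub_kermxP; rewrite nz_row_sub.
Qed.

Lemma unit_vector n (w : 'rV[K]_n) : w != 0 ->
  exists2 a : R, a != 0 & (Kreal a *: w) *m adj (Kreal a *: w) = 1%:M.
Proof.
move=> w0; pose s := \sum_j (Kre (w 0 j) ^+ 2 + Kim (w 0 j) ^+ 2).
have sE : w *m adj w = (Kreal s)%:M.
  by rewrite [LHS]mx11_scalar mulmx_adj_diag.
have s0 : 0 < s.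
  rewrite lt_neqAle sumr_ge0 ?andbT => [|j _]; last by rewrite addr_ge0 ?sqr_ge0.
  apply: contra w0 => /eqP s0; apply/eqP/mulmx_adj_eq0.
  by rewrite sE -s0 raddf0 raddf0.
have q0 : Num.sqrt s != 0 by rewrite sqrtr_eq0 -ltNge.
exists (Num.sqrt s)^-1; first by rewrite invr_eq0.
rewrite adjZ -scalemxAl -scalemxAr Kconj_real sE.
apply/matrixP => i j; rewrite !ord1 !mxE eqxx mulr1n mulr1n -!rmorphM/=.
by rewrite mulrA -expr2 exprVn sqr_sqrtr ?ltW// mulVf ?gt_eqF// rmorph1.
Qed.

Lemma complete_orthonormal_rows n (v : 'rV[K]_n.+1) : v *m adj v = 1%:M ->
  exists U : 'M[K]_n.+1, U *m adj U = 1%:M /\ row 0 U = v.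
Proof.
move=> vv.
have orth0 i j : (i < 1)%N -> (j < 1)%N -> (v *m adj v) 0 0 = (i == j)%:R.
  by case: i => //; case: j => // _ _; rewrite vv mxE.
have [] := @extend_orthonormal _ (fun v w => (v *m adj w) 0 0) (fun=> True)
    n.+1 1 (fun=> v) _ _ (ltn0Sn n) (fun _ _ => I) orth0.
- move=> x y _ _ xy; rewrite -[x]adjK -adjM adjE xy.
  by rewrite raddf0.
- move=> m e mn _.
  have [w [w0 wG]] := left_kernel_vector (adj (\matrix_(i < m) e i)) mn.
  have [a a0 aw] := unit_vector w0.
  exists (Kreal a *: w); split=> // [|i im]; first by rewrite aw mxE.
  have := congr1 (fun A : 'M[K]_(1, m) => A 0 (Ordinal im)) wG.
  rewrite -scalemxAl !mxE => wG'.
  transitivity (Kreal a * 0 : K); last by rewrite mulr0.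
  by congr (_ * _); rewrite -[RHS]wG'; apply: eq_bigr => j _; rewrite !adjE !mxE.
move=> e [e0 _ orth]; exists (\matrix_(i < n.+1) e i); split.
  apply/matrixP => i j; rewrite mxE.
  transitivity ((e i *m adj (e j)) 0 0); last first.
    by rewrite orth// mxE.
  by rewrite mxE; apply: eq_bigr => l _; rewrite !adjE !mxE.
by rewrite rowK e0.
Qed.

(** Deflation: in an orthonormal basis starting with an eigenvector the matrix is
block diagonal, with a Hermitian block of smaller size. *)
Lemma hermitian_diagonalization n (M : 'M[K]_n) : adj M = M ->
  exists2 U : 'M[K]_n, U *m adj U = 1%:M & is_diag_mx (U *m M *m adj U).
Proof.
elim: n M => [|n IH] M hM.
  by exists 1%:M; [rewrite adj1 mulmx1|apply/is_diag_mxP => -[]].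
have [a [v [v0 vM]]] := hermitian_eigenvector hM.
have [b b0 bv] := unit_vector v0.
have [Q [QQ Q0]] := complete_orthonormal_rows bv.
have [M1 M1E] : exists M1 : 'M[K]_(1 + n), M1 = Q *m M *m adj Q by eexists.
have hM1 : adj M1 = M1 by rewrite M1E !adjM adjK hM mulmxA.
have ur0 : ursubmx M1 = 0.
  have row0 : row 0 M1 = Kreal a *: row 0 (1%:M : 'M[K]_n.+1).
    rewrite M1E !row_mul Q0 -scalemxAl vM scalerA mulrC -scalerA.
    by rewrite -Q0 -scalemxAl -row_mul QQ.
  apply/matrixP => i j; rewrite ord1 !mxE.
  have := congr1 (fun A : 'M[K]_(1, n.+1) => A 0 (rshift 1 j)) row0.
  rewrite !mxE => h; rewrite [LHS](_ : _ = M1 0 (rshift 1 j)); last first.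
    by congr (M1 _ _); apply/val_inj.
  by rewrite h (_ : _ == _ = false) ?mulr0.
have dl0 : dlsubmx M1 = 0.
  apply/matrixP => i j; have := congr1 (fun A : 'M[K]_(1, n) => A j i) ur0.
  rewrite !mxE => h.
  have -> : M1 (rshift 1 i) (lshift n j) = Kconj (M1 (lshift n j) (rshift 1 i)).
    by rewrite -adjE hM1.
  by rewrite h raddf0.
have hM' : adj (drsubmx M1) = drsubmx M1.
  apply/matrixP => i j; rewrite adjE !mxE.
  by rewrite -[in RHS]hM1 adjE.
have [U' UU' dU'] := IH _ hM'.
pose B : 'M[K]_(1 + n) := block_mx 1%:M 0 0 U'.
have adjB : adj B = block_mx 1%:M 0 0 (adj U').
  by rewrite /B /adj map_block_mx tr_block_mx !map_mx0 !trmx0 map_mx1 trmx1.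
have BB : B *m adj B = 1%:M.
  rewrite adjB /B mulmx_block.
  by rewrite !(mulmx0, mul0mx, addr0, add0r, mulmx1) UU' -scalar_mx_block.
have dB : is_diag_mx (B *m M1 *m adj B).
  rewrite -[M1]submxK ur0 dl0 adjB /B !mulmx_block.
  rewrite !(mulmx0, mul0mx, addr0, add0r, mulmx1, mul1mx).
  by rewrite is_diag_block_mx// !eqxx/= dU' andbT mx11_is_diag.
exists (B *m Q).
  by rewrite adjM mulmxA -[B *m Q *m _]mulmxA QQ mulmx1; exact: BB.
by move: dB; rewrite M1E adjM !mulmxA.
Qed.

End OrthonormalExtension.

(** * Measurable subsets of the plane *)

Section ComplexPlaneMeasure.
Context (R : realType).

Lemma measurable_planeE (A : set (R * R)) :
  measurable A -> measurable (@plane_coord R @^-1` A).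
Proof. by move=> mA; exists A => //; rewrite setTI. Qed.

Lemma open_square (Omega : set R[i]) (x0 y0 : R) :
  open (Omega : set R[i]^o) -> Omega (x0 +i* y0) ->
  exists2 e : R, 0 < e & forall x y : R,
    `|x - x0| < e -> `|y - y0| < e -> Omega (x +i* y).
Proof.
move=> oO Oz0; have /nbhs_ballP[d /= d0 dO] : nbhs (x0 +i* y0 : R[i]^o) Omega.
  exact: open_nbhs_nbhs.
have [/eqP dI dR] : complex.Im d == 0 /\ 0 < complex.Re d.
  by move: d0; rewrite ltcE/= => /andP.
exists (complex.Re d / 2); first by rewrite divr_gt0.
move=> x y xR yI; apply: dO; rewrite /ball/= normc_def ltcE/= dI eqxx/=.
rewrite -[ltRHS]gtr0_norm// -[ltRHS]sqrtr_sqr ltr_sqrt ?exprn_gt0//.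
have h (a b : R) : `|b - a| < complex.Re d / 2 ->
    (a - b) ^+ 2 < (complex.Re d) ^+ 2 / 4.
  rewrite distrC => h; rewrite -[(a - b) ^+ 2]real_normK ?num_real//.
  have -> : complex.Re d ^+ 2 / 4 = (complex.Re d / 2) ^+ 2 by field.
  by rewrite ltrXn2r// nnegrE ltW// divr_gt0.
have := h _ _ xR; have := h _ _ yI.
have : 0 < complex.Re d ^+ 2 by rewrite exprn_gt0.
lra.
Qed.

(** The sigma-algebra on the plane is generated by rectangles, so an open set is
exhibited as the countable union of the rational rectangles that it contains. *)
Lemma measurable_open (Omega : set R[i]) :
  open (Omega : set R[i]^o) -> measurable Omega.
Proof.
move=> oO.
pose box (q : (rat * rat) * (rat * rat)) : set (R * R) :=
  [set` `]ratr q.1.1, ratr q.1.2[] `*` [set` `]ratr q.2.1, ratr q.2.2[].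
pose good q := forall p, box q p -> Omega (plane_point p).
pose F q := if pselect (good q) then box q else set0.
have -> : Omega = plane_coord @^-1` (\bigcup_q F q).
  apply/seteqP; split => [[x y] Oxy|[x y] [q _]]; last first.
    by rewrite /F /=; case: (pselect (good q)) => [gq qxy|//]; exact: (gq (x, y) qxy).
  have [e e0 eO] := open_square oO Oxy.
  have lte (a : R) : a - e < a by rewrite ltrBlDr ltrDl.
  have gte (a : R) : a < a + e by rewrite ltrDl.
  have [a1 a1P] := rat_in_itvoo (lte x); have [a2 a2P] := rat_in_itvoo (gte x).
  have [b1 b1P] := rat_in_itvoo (lte y); have [b2 b2P] := rat_in_itvoo (gte y).
  rewrite !in_itv/= in a1P a2P b1P b2P.
  move: a1P a2P b1P b2P => /andP[a1x a1l] /andP[a2x a2l] /andP[b1y b1l] /andP[b2y b2l].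
  exists ((a1, a2), (b1, b2)) => //.
  have gq : good ((a1, a2), (b1, b2)).
    case=> u v; rewrite /box /= !in_itv/= => -[/andP[u1 u2] /andP[v1 v2]].
    by apply: eO; rewrite ltr_distl ?(lt_trans a1x) ?(lt_trans b1y)//
      ?(lt_trans u2) ?(lt_trans v2).
  rewrite /F /=; case: (pselect (good (a1, a2, (b1, b2)))) => [gq'|//].
  by split; rewrite /= in_itv/= ?a1l ?a2x ?b1l ?b2y.
apply: measurable_planeE.
apply: (@countable_bigcupT_measurable _ (R * R)%type _ F) => [|q].
  exact: countableP.
rewrite /F; case: pselect => ?; last exact: measurable0.
by apply: measurableX; exact: measurable_itv.
Qed.

(** A square inside Omega is cut into n vertical strips of equal width. Their
indicators witness that the space of square-integrable functions on a domain has
infinite dimension. *)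
Lemma disjoint_pieces (Omega : set R[i]) n : domain Omega ->
  exists S : 'I_n -> set R[i], [/\ forall i, measurable (S i),
    forall i, S i `<=` Omega,
    forall i j z, S i z -> S j z -> i = j &
    exists2 m : R, 0 < m & forall i, plane_lebesgue (S i) = m%:E].
Proof.
move=> [oO _ [[x0 y0] O0]]; have [e e0 eO] := open_square oO O0.
case: n => [|n]; first by exists (fun=> set0); split=> [[]|[]|[]|]//; exists 1 => // -[].
pose h := e / n.+1%:R.
have h0 : 0 < h by rewrite divr_gt0.
pose Ix (i : 'I_n.+1) : set R := [set` `[x0 + h * i%:R, x0 + h * i.+1%:R[].
pose Iy : set R := [set` `[y0, y0 + e[].
exists (fun i => plane_coord @^-1` (Ix i `*` Iy)); split.
- by move=> i; apply: measurable_planeE; apply: measurableX; exact: measurable_itv.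
- move=> i [x y] [/=]; rewrite /Ix /Iy /= !in_itv/= => /andP[x1 x2] /andP[y1 y2].
  have hi : h * i.+1%:R <= e.
    rewrite /h mulrAC ler_pdivrMr ?ltr0n// ler_wpM2l ?(ltW e0)//.
    by rewrite ler_nat ltn_ord.
  have hi0 : 0 <= h * i%:R by apply: mulr_ge0 => //; exact: ltW.
  by apply: eO; rewrite ger0_norm; lra.
- have key (i j : 'I_n.+1) x : Ix i x -> Ix j x -> (i <= j)%N.
    rewrite /Ix/= !in_itv/= => /andP[x1 _] /andP[_ x2].
    have := le_lt_trans x1 x2; rewrite ltrD2l ltr_pM2l// ltr_nat.
    by rewrite ltnS.
  move=> i j [x y] [/= xi _] [/= xj _].
  by apply/val_inj/eqP; rewrite eqn_leq (key i j x)// (key j i x).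
- exists (h * e); first by rewrite mulr_gt0.
  move=> i; rewrite /plane_lebesgue /pushforward.
  rewrite (_ : _ @^-1` _ = Ix i `*` Iy); last by apply/seteqP; split => -[].
  rewrite product_measure1E; [|exact: measurable_itv|exact: measurable_itv].
  rewrite /= /Ix /Iy !lebesgue_measure_itv/= !lte_fin.
  rewrite ltrD2l ltr_pM2l// ltr_nat ltnSn ltrDl e0 -!EFinB -EFinM.
  by congr EFin; rewrite -natr1; ring.
Qed.

End ComplexPlaneMeasure.

(** * Gram matrices of square-integrable functions *)

Section GramMatrix.
Context (R : realType) (k : scalars).
Local Notation K := (Kfield R k).
Local Notation mu := (@plane_lebesgue R).
Variable Omega : set R[i].
Hypothesis mO : measurable Omega.

Definition Kintegrable (phi : R[i] -> K) : Prop :=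
  mu.-integrable Omega (EFin \o (fun z => Kre (phi z))) /\
  mu.-integrable Omega (EFin \o (fun z => Kim (phi z))).

Definition Kint (phi : R[i] -> K) : K :=
  Kmk (\int[mu]_(z in Omega) Kre (phi z)) (\int[mu]_(z in Omega) Kim (phi z)).

Lemma Kre_int phi : Kre (Kint phi) = \int[mu]_(z in Omega) Kre (phi z).
Proof. by rewrite /Kint; case: k phi. Qed.

Lemma Kim_int phi : Kim (Kint phi) = \int[mu]_(z in Omega) Kim (phi z).
Proof.
rewrite /Kint; case: k phi => //= phi.
by rewrite Rintegral_cst// mul0r.
Qed.

Lemma integrable_linear (a b : R) (f g : R[i] -> R) :
  mu.-integrable Omega (EFin \o f) -> mu.-integrable Omega (EFin \o g) ->
  mu.-integrable Omega (EFin \o (fun z => a * f z + b * g z)).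
Proof.
move=> hf hg.
have := integrableD mO (integrableZl mO a hf) (integrableZl mO b hg).
by apply: eq_integrable.
Qed.

Lemma Rintegral_linear (a b : R) (f g : R[i] -> R) :
  mu.-integrable Omega (EFin \o f) -> mu.-integrable Omega (EFin \o g) ->
  \int[mu]_(z in Omega) (a * f z + b * g z) =
  a * \int[mu]_(z in Omega) f z + b * \int[mu]_(z in Omega) g z.
Proof.
move=> hf hg.
have h (c : R) e : mu.-integrable Omega (EFin \o e) ->
    mu.-integrable Omega (EFin \o (fun z => c * e z)).
  by move=> he; have := integrableZl mO c he; apply: eq_integrable.
by rewrite RintegralD// ?RintegralZl//; exact: h.
Qed.

Lemma Kintegrable_linear (a : K) phi psi : Kintegrable phi -> Kintegrable psi ->
  Kintegrable (fun z => a * phi z + psi z).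
Proof.
move=> [fr fi] [gr gi]; split.
  have := integrable_linear 1 1 (integrable_linear (Kre a) (- Kim a) fr fi) gr.
  apply: eq_integrable => // z _ /=; congr EFin.
  by rewrite !KpartsE; ring.
have := integrable_linear 1 1 (integrable_linear (Kre a) (Kim a) fi fr) gi.
apply: eq_integrable => // z _ /=; congr EFin.
by rewrite !KpartsE; ring.
Qed.

Lemma Kint_linear (a : K) phi psi : Kintegrable phi -> Kintegrable psi ->
  Kint (fun z => a * phi z + psi z) = a * Kint phi + Kint psi.
Proof.
move=> [fr fi] [gr gi]; apply: Kext; rewrite !KpartsE ?Kre_int ?Kim_int.
  have := Rintegral_linear 1 1 (integrable_linear (Kre a) (- Kim a) fr fi) gr.
  rewrite (Rintegral_linear (Kre a) (- Kim a) fr fi) !mul1r mulNr => <-.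
  by apply: eq_Rintegral => z _; rewrite !KpartsE; ring.
have := Rintegral_linear 1 1 (integrable_linear (Kre a) (Kim a) fi fr) gi.
rewrite (Rintegral_linear (Kre a) (Kim a) fi fr) !mul1r => <-.
by apply: eq_Rintegral => z _; rewrite !KpartsE; ring.
Qed.

Lemma Kintegrable0 : Kintegrable (fun=> 0).
Proof.
split; [have -> : EFin \o (fun=> Kre (0 : K)) = (cst 0%E : R[i] -> \bar R)|
        have -> : EFin \o (fun=> Kim (0 : K)) = (cst 0%E : R[i] -> \bar R)].
- by apply/funext => z /=; rewrite raddf0.
- exact: integrable0.
- by apply/funext => z /=; rewrite raddf0.
- exact: integrable0.
Qed.

Lemma Kint0 : Kint (fun=> 0) = 0.
Proof.
by apply: Kext; rewrite ?Kre_int ?Kim_int !raddf0 Rintegral_cst// mul0r.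
Qed.

Lemma Kint_sum_seq (I : Type) (s : seq I) (c : I -> K) (phi : I -> R[i] -> K) :
  (forall i, Kintegrable (phi i)) ->
  Kintegrable (fun z => \sum_(i <- s) c i * phi i z) /\
  Kint (fun z => \sum_(i <- s) c i * phi i z) = \sum_(i <- s) c i * Kint (phi i).
Proof.
move=> hphi; elim: s => [|i s [IH1 IH2]].
  have -> : (fun z => \sum_(i <- [::]) c i * phi i z) = (fun=> 0).
    by apply/funext => z; rewrite big_nil.
  by rewrite big_nil Kint0; split => //; exact: Kintegrable0.
have -> : (fun z => \sum_(i <- i :: s) c i * phi i z) =
    (fun z => c i * phi i z + \sum_(i <- s) c i * phi i z).
  by apply/funext => z; rewrite big_cons.
split; first exact: Kintegrable_linear.
by rewrite Kint_linear// big_cons IH2.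
Qed.

Lemma Kintegrable_sum (I : finType) (c : I -> K) (phi : I -> R[i] -> K) :
  (forall i, Kintegrable (phi i)) ->
  Kintegrable (fun z => \sum_i c i * phi i z).
Proof. by move=> /(Kint_sum_seq (index_enum I) c)[]. Qed.

Lemma Kint_sum (I : finType) (c : I -> K) (phi : I -> R[i] -> K) :
  (forall i, Kintegrable (phi i)) ->
  Kint (fun z => \sum_i c i * phi i z) = \sum_i c i * Kint (phi i).
Proof. by move=> /(Kint_sum_seq (index_enum I) c)[]. Qed.

Lemma norm2_sq_ge0 m (v : 'cV[K]_m) : 0 <= norm2_sq v.
Proof. by apply: sumr_ge0 => i _; rewrite addr_ge0 ?sqr_ge0. Qed.

Lemma norm2_sq_coord m (v : 'cV[K]_m) i :
  Kre (v i 0) ^+ 2 + Kim (v i 0) ^+ 2 <= norm2_sq v.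
Proof.
rewrite /norm2_sq (bigD1 i)//= lerDl.
by apply: sumr_ge0 => j _; rewrite addr_ge0 ?sqr_ge0.
Qed.

Lemma norm2_sqE m (v : 'cV[K]_m) :
  norm2_sq v = \sum_i Kre (v i 0 * Kconj (v i 0)).
Proof. by apply: eq_bigr => i _; rewrite mulKconj Kre_real. Qed.

Lemma measurable_norm2_sq m (h : R[i] -> 'cV[K]_m) : measurable_vec Omega h ->
  measurable_fun Omega (fun z => norm2_sq (h z)).
Proof.
move=> mh; apply: measurable_sum => i.
by apply: measurable_funD; apply: measurable_funX; have [] := mh i.
Qed.

Lemma L2_integrable m (h : R[i] -> 'cV[K]_m) : L2 Omega h ->
  mu.-integrable Omega (EFin \o (fun z => norm2_sq (h z))).
Proof.
move=> [mh hoo]; apply/integrableP; split.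
  by apply/measurable_EFinP; exact: measurable_norm2_sq.
by under eq_integral do rewrite /= ger0_norm ?norm2_sq_ge0//.
Qed.

(** Each part of x y^* is at most |x|^2 + |y|^2 in absolute value. *)
Lemma L2_mul_conj m n (h : R[i] -> 'cV[K]_m) (g : R[i] -> 'cV[K]_n) i j :
  L2 Omega h -> L2 Omega g -> Kintegrable (fun z => h z i 0 * Kconj (g z j 0)).
Proof.
move=> hL gL; have [[mhr mhi] [mgr mgi]] := (hL.1 i, gL.1 j).
have ihg : mu.-integrable Omega
    (EFin \o (fun z => norm2_sq (h z) + norm2_sq (g z))).
  have := integrableD mO (L2_integrable hL) (L2_integrable gL).
  exact: eq_integrable.
have dom (f : R[i] -> R) : measurable_fun Omega f ->
    (forall z, `|f z| <= Kre (h z i 0) ^+ 2 + Kim (h z i 0) ^+ 2 +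
      (Kre (g z j 0) ^+ 2 + Kim (g z j 0) ^+ 2)) ->
    mu.-integrable Omega (EFin \o f).
  move=> mf fle; apply: le_integrable ihg => //; first exact/measurable_EFinP.
  move=> z _ /=; rewrite lee_fin [leRHS]ger0_norm ?addr_ge0 ?norm2_sq_ge0//.
  by rewrite (le_trans (fle z))// lerD ?norm2_sq_coord.
have cs (a b c e : R) : `|a * c + b * e| <= a ^+ 2 + b ^+ 2 + (c ^+ 2 + e ^+ 2).
  have xy_le (x y : R) : - (x ^+ 2 + y ^+ 2) <= x * y <= x ^+ 2 + y ^+ 2.
    have := sqr_ge0 (x + y); have := sqr_ge0 (x - y).
    have := sqr_ge0 x; have := sqr_ge0 y.
    by rewrite sqrrB sqrrD => *; apply/andP; split; lra.
  rewrite ler_norml; have /andP[] := xy_le a c; have /andP[] := xy_le b e.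
  by move=> *; apply/andP; split; lra.
split; apply: dom.
- rewrite (_ : (fun z => _) = (fun z => Kre (h z i 0) * Kre (g z j 0) +
    Kim (h z i 0) * Kim (g z j 0))); last first.
    by apply/funext => z; rewrite !KpartsE; ring.
  by apply: measurable_funD; exact: measurable_funM.
- by move=> z; rewrite !KpartsE mulrN opprK cs.
- rewrite (_ : (fun z => _) = (fun z => Kim (h z i 0) * Kre (g z j 0) -
    Kre (h z i 0) * Kim (g z j 0))); last first.
    by apply/funext => z; rewrite !KpartsE; ring.
  by apply: measurable_funB; exact: measurable_funM.
- move=> z; rewrite !KpartsE.
  have := cs (Kim (h z i 0)) (Kre (h z i 0)) (Kre (g z j 0)) (- Kim (g z j 0)).
  by rewrite sqrrN addrC [X in _ <= X + _]addrC.
Qed.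

(** Membership in L2 reduced to scalar integrability, which is stable under finite
linear combinations ([Kintegrable_sum]). *)
Lemma L2P m (h : R[i] -> 'cV[K]_m) : measurable_vec Omega h ->
  (forall i, Kintegrable (fun z => h z i 0 * Kconj (h z i 0))) -> L2 Omega h.
Proof.
move=> mh ih; split => //.
have : mu.-integrable Omega (fun z => \sum_(i < m) (Kre (h z i 0 * Kconj (h z i 0)))%:E)%E.
  by apply: integrable_sum => // i _; have [] := ih i.
move=> /integrableP[_]; apply: le_lt_trans; apply: ge0_le_integral => //.
- by move=> z _; rewrite lee_fin norm2_sq_ge0.
- by apply/measurable_EFinP; exact: measurable_norm2_sq.
- apply: measurableT_comp => //; apply: emeasurable_sum => i.
  by have [/measurable_int] := ih i.
- by move=> z _; rewrite sumEFin -norm2_sqE /= lee_fin ler_norm.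
Qed.

Lemma L2_mulmx m n (A : 'M[K]_(n, m)) (h : R[i] -> 'cV[K]_m) :
  L2 Omega h -> L2 Omega (fun z => A *m h z).
Proof.
move=> hL; apply: L2P.
  move=> i; split.
    rewrite (_ : (fun z => _) = (fun z => \sum_j (Kre (A i j) * Kre (h z j 0)
        - Kim (A i j) * Kim (h z j 0)))); last first.
      by apply/funext => z; rewrite mxE raddf_sum; apply: eq_bigr => j _; exact: KreM.
    apply: measurable_sum => j; have [mr mi] := hL.1 j.
    by apply: measurable_funB; apply: measurable_funM.
  rewrite (_ : (fun z => _) = (fun z => \sum_j (Kre (A i j) * Kim (h z j 0)
        + Kim (A i j) * Kre (h z j 0)))); last first.
    by apply/funext => z; rewrite mxE raddf_sum; apply: eq_bigr => j _; exact: KimM.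
  apply: measurable_sum => j; have [mr mi] := hL.1 j.
  by apply: measurable_funD; apply: measurable_funM.
move=> i.
rewrite (_ : (fun z => _) = (fun z => \sum_j A i j *
    \sum_l Kconj (A i l) * (h z j 0 * Kconj (h z l 0)))).
  by do 2!apply: Kintegrable_sum => ?; exact: L2_mul_conj.
apply/funext => z; rewrite !mxE raddf_sum/= mulr_suml; apply: eq_bigr => j _.
rewrite !mulr_sumr; apply: eq_bigr => l _; rewrite rmorphM/=; ring.
Qed.

Lemma L2_sub m (h g : R[i] -> 'cV[K]_m) :
  L2 Omega h -> L2 Omega g -> L2 Omega (fun z => h z - g z).
Proof.
move=> hL gL; apply: L2P.
  move=> i; have [hr hi] := hL.1 i; have [gr gi] := gL.1 i; split.
    rewrite (_ : (fun z => _) = (fun z => Kre (h z i 0) - Kre (g z i 0))).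
      exact: measurable_funB.
    by apply/funext => z; rewrite !mxE !KpartsE.
  rewrite (_ : (fun z => _) = (fun z => Kim (h z i 0) - Kim (g z i 0))).
    exact: measurable_funB.
  by apply/funext => z; rewrite !mxE !KpartsE.
move=> i; rewrite (_ : (fun z => _) = (fun z => 1 * (h z i 0 * Kconj (h z i 0)) +
  (-1 * (h z i 0 * Kconj (g z i 0)) + (-1 * (g z i 0 * Kconj (h z i 0)) +
  g z i 0 * Kconj (g z i 0))))); last first.
  by apply/funext => z; rewrite !mxE rmorphB/=; ring.
by do 3!(apply: Kintegrable_linear; first exact: L2_mul_conj); exact: L2_mul_conj.
Qed.

Definition gram m n (h : R[i] -> 'cV[K]_m) (g : R[i] -> 'cV[K]_n) : 'M[K]_(m, n) :=
  \matrix_(i, j) Kint (fun z => h z i 0 * Kconj (g z j 0)).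

Lemma gram_adj m n (h : R[i] -> 'cV[K]_m) (g : R[i] -> 'cV[K]_n) :
  L2 Omega h -> L2 Omega g -> adj (gram h g) = gram g h.
Proof.
move=> hL gL; apply/matrixP => i j; rewrite adjE !mxE; apply: Kext.
  rewrite Kre_conj !Kre_int; apply: eq_Rintegral => z _.
  by rewrite !KpartsE; ring.
rewrite Kim_conj !Kim_int -mulN1r.
have [_ i2] := L2_mul_conj j i hL gL.
rewrite -RintegralZl//; apply: eq_Rintegral => z _.
by rewrite !KpartsE; ring.
Qed.

Lemma gram_mulmxl m n p (A : 'M[K]_(p, m)) (h : R[i] -> 'cV[K]_m)
    (g : R[i] -> 'cV[K]_n) : L2 Omega h -> L2 Omega g ->
  gram (fun z => A *m h z) g = A *m gram h g.
Proof.
move=> hL gL; apply/matrixP => i j; rewrite !mxE.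
under [RHS]eq_bigr do rewrite mxE.
rewrite -Kint_sum; last by move=> l; exact: L2_mul_conj.
congr Kint; apply/funext => z; rewrite mxE mulr_suml.
by apply: eq_bigr => l _; rewrite mulrA.
Qed.

Lemma gram_mulmx m n p q (A : 'M[K]_(p, m)) (B : 'M[K]_(q, n))
    (h : R[i] -> 'cV[K]_m) (g : R[i] -> 'cV[K]_n) : L2 Omega h -> L2 Omega g ->
  gram (fun z => A *m h z) (fun z => B *m g z) = A *m gram h g *m adj B.
Proof.
move=> hL gL; have BgL := L2_mulmx B gL.
rewrite gram_mulmxl// -mulmxA; congr (_ *m _).
by rewrite -(gram_adj BgL hL) gram_mulmxl// adjM gram_adj.
Qed.

Lemma L2norm_gram m (h : R[i] -> 'cV[K]_m) : L2 Omega h ->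
  L2norm Omega h ^+ 2 = \sum_i Kre (gram h h i i).
Proof.
move=> hL; rewrite /L2norm sqr_sqrtr; last first.
  by apply: Rintegral_ge0 => z _; exact: norm2_sq_ge0.
under [RHS]eq_bigr do rewrite mxE Kre_int.
have ih i : mu.-integrable Omega (EFin \o (fun z => Kre (h z i 0 * Kconj (h z i 0)))).
  by have [] := L2_mul_conj i i hL hL.
rewrite /Rintegral -[RHS]/(fine (\sum_i \int[mu]_(z in Omega) Kre (h z i 0 * Kconj (h z i 0)))%:E).
rewrite -sumEFin; congr fine.
transitivity (\sum_i \int[mu]_(z in Omega) (Kre (h z i 0 * Kconj (h z i 0)))%:E)%E.
  rewrite -integral_sum//; apply: eq_integral => z _.
  by rewrite sumEFin norm2_sqE.
by apply: eq_bigr => i _; apply/esym/fineK/(integrable_fin_num mO)/(ih i).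
Qed.

Lemma L2norm_ae m (h g : R[i] -> 'cV[K]_m) : L2 Omega h -> L2 Omega g ->
  aeeq Omega h g -> L2norm Omega h = L2norm Omega g.
Proof.
move=> hL gL hg; rewrite /L2norm; congr (Num.sqrt (fine _)).
apply: ae_eq_integral => //.
- by apply/measurable_EFinP; apply: measurable_norm2_sq; exact: hL.1.
- by apply/measurable_EFinP; apply: measurable_norm2_sq; exact: gL.1.
- by apply: filterS hg => z hz /hz ->.
Qed.

Lemma gram_diag_eq0 m (h : R[i] -> 'cV[K]_m) i : L2 Omega h ->
  Kre (gram h h i i) = 0 -> {ae mu, forall z, Omega z -> h z i 0 = 0}.
Proof.
move=> hL; rewrite mxE Kre_int => h0.
have [ih _] := L2_mul_conj i i hL hL.
have h0' : (\int[mu]_(z in Omega) `|(Kre (h z i 0 * Kconj (h z i 0)))%:E| = 0)%E.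
  transitivity (\int[mu]_(z in Omega) (Kre (h z i 0 * Kconj (h z i 0)))%:E)%E.
    apply: eq_integral => z _; rewrite gee0_abs// lee_fin mulKconj Kre_real.
    by rewrite addr_ge0 ?sqr_ge0.
  by rewrite -[LHS](fineK (integrable_fin_num mO ih)); congr EFin.
have := ae_eq_integral_abs mu mO (measurable_int _ ih).
move=> [+ _] => /(_ h0'); apply: filterS => z hz Oz.
have := hz Oz => -[]; rewrite mulKconj Kre_real => /eqP.
rewrite paddr_eq0 ?sqr_ge0// !sqrf_eq0 => /andP[/eqP a /eqP b].
by apply: Kext; rewrite ?a ?b !KpartsE.
Qed.

End GramMatrix.

(** * Singular value decomposition *)

Section SingularValues.
Context (R : realType) (k : scalars).
Local Notation K := (Kfield R k).
Local Notation mu := (@plane_lebesgue R).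
Variable Omega : set R[i].
Hypothesis mO : measurable Omega.

Lemma L2inner_gram (v w : R[i] -> 'cV[K]_1) :
  L2inner Omega v w = gram Omega v w 0 0.
Proof. by rewrite mxE. Qed.

Lemma L2_stack N (v : 'I_N -> R[i] -> 'cV[K]_1) : (forall j, L2 Omega (v j)) ->
  L2 Omega (fun z => \col_j v j z 0 0).
Proof.
move=> vL; apply: L2P => // i.
  have [mr mi] := (vL i).1 0; split.
    by rewrite (_ : (fun z => _) = (fun z => Kre (v i z 0 0)))//; apply/funext => z; rewrite mxE.
  by rewrite (_ : (fun z => _) = (fun z => Kim (v i z 0 0)))//; apply/funext => z; rewrite mxE.
rewrite (_ : (fun z => _) = (fun z => v i z 0 0 * Kconj (v i z 0 0))).
  exact: L2_mul_conj.
by apply/funext => z; rewrite mxE.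
Qed.

Lemma gram_stack M N (v : 'I_M -> R[i] -> 'cV[K]_1) (w : 'I_N -> R[i] -> 'cV[K]_1) i j :
  gram Omega (fun z => \col_j v j z 0 0) (fun z => \col_j w j z 0 0) i j =
  L2inner Omega (v i) (w j).
Proof.
rewrite L2inner_gram !mxE; congr Kint; apply/funext => z.
by rewrite !mxE.
Qed.

(** In matrix form h = X v almost everywhere, where column j of X is sigma_j u_j and
the Gram matrix of v is the identity. The Gram matrix of B h is then
(B X)(B X)^*, and its trace is the claimed sum. *)
Lemma svd_norm N (h : R[i] -> 'cV[K]_N) u v sigma m (B : 'M[K]_(m, N)) :
  L2 Omega h -> is_svd Omega h u v sigma ->
  L2norm Omega (fun z => B *m h z) ^+ 2 =
  \sum_(j < N) sigma j ^+ 2 * norm2_sq (B *m u j).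
Proof.
move=> hL [uorth [vL vorth] _ hE].
pose vs z : 'cV[K]_N := \col_j v j z 0 0.
have vsL : L2 Omega vs by exact: L2_stack.
have gvs : gram Omega vs vs = 1%:M.
  by apply/matrixP => i j; rewrite gram_stack vorth mxE.
pose X : 'M[K]_N := \matrix_(i, j) (Kreal (sigma j) * u j i 0).
have hX : aeeq Omega (fun z => B *m h z) (fun z => (B *m X) *m vs z).
  apply: filterS hE => z hz Oz; rewrite hz// -mulmxA; congr (_ *m _).
  apply/matrixP => i j; rewrite ord1 !mxE summxE; apply: eq_bigr => l _.
  by rewrite !mxE; ring.
rewrite (L2norm_ae mO (L2_mulmx mO B hL) (L2_mulmx mO (B *m X) vsL) hX).
rewrite L2norm_gram//; last exact: L2_mulmx.
rewrite gram_mulmx// gvs mulmx1.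
under eq_bigr do rewrite mulmx_adj_diag Kre_real.
rewrite exchange_big/=; apply: eq_bigr => j _.
rewrite /norm2_sq mulr_sumr; apply: eq_bigr => i _.
have -> : (B *m X) i j = Kreal (sigma j) * (B *m u j) i 0.
  rewrite !mxE mulr_sumr; apply: eq_bigr => l _.
  by rewrite mxE; ring.
by rewrite !KpartsE; ring.
Qed.

(** Of the n + 1 indicators of disjoint pieces of equal measure, which are orthogonal
and of equal norm, some nontrivial combination is orthogonal to the n given
functions. *)
Lemma L2_extend_orthonormal (e : nat -> R[i] -> 'cV[K]_1) n : domain Omega ->
  (forall i, (i < n)%N -> L2 Omega (e i)) ->
  exists w, [/\ L2 Omega w, L2inner Omega w w = 1 &
    forall i, (i < n)%N -> L2inner Omega w (e i) = 0].
Proof.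
move=> dO eL; have [S [mS SO Sdisj [m m0 Sm]]] := disjoint_pieces n.+1 dO.
pose g (z : R[i]) : 'cV[K]_n.+1 := \col_a Kreal (\1_(S a) z).
have gparts a z : (Kre (g z a 0) = \1_(S a) z) * (Kim (g z a 0) = 0).
  by rewrite !mxE !KpartsE.
have S_ind a : mu.-integrable Omega (EFin \o (fun z => (\1_(S a) z : R))).
  apply/integrableP; split.
    by apply/measurable_EFinP; apply: measurable_funTS; exact: measurable_indic.
  under eq_integral do rewrite /= ger0_norm//.
  rewrite integral_indic// (_ : S a `&` Omega = S a); last exact/setIidl/SO.
  by apply: (eq_ind_r (fun x => x < +oo)%E _ (Sm a)); exact: ltry.
have ggE a b z : g z a 0 * Kconj (g z b 0) = Kreal ((a == b)%:R * \1_(S a) z).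
  apply: Kext; rewrite !KpartsE !gparts !(mul0r, mulr0, oppr0, subr0, addr0)//.
  have [->|ab] := eqVneq a b; first by rewrite mul1r !indicE -natrM mulnb andbb.
  rewrite mul0r !indicE; have [za|] := boolP (z \in S a); last by rewrite mul0r.
  have [zb|] := boolP (z \in S b); last by rewrite mulr0.
  by move: ab; rewrite (Sdisj a b z) ?eqxx// -in_setE.
have gL : L2 Omega g.
  apply: L2P => // a.
    split; [rewrite (_ : (fun z => _) = \1_(S a))|rewrite (_ : (fun z => _) = cst 0)] => //.
    - by apply/funext => z; rewrite gparts.
    - by apply/funext => z; rewrite gparts.
  split.
    apply: eq_integrable (S_ind a) => // z _ /=.
    by rewrite ggE eqxx mul1r Kre_real.
  have [_] := @Kintegrable0 R k Omega; apply: eq_integrable => // z _ /=.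
  by rewrite ggE !KpartsE.
have gg : gram Omega g g = (Kreal m)%:M.
  apply/matrixP => a b; rewrite !mxE; apply: Kext; rewrite ?Kre_int ?Kim_int//.
    under eq_Rintegral do rewrite ggE Kre_real.
    rewrite RintegralZl//; have [->|ab] := eqVneq a b; last first.
      by rewrite mul0r KpartsE.
    rewrite mul1r mulr1n Kre_real /Rintegral integral_indic//.
    rewrite (_ : S b `&` Omega = S b); last exact/setIidl/SO.
    by rewrite -[RHS]/(fine m%:E) -(Sm b).
  under eq_Rintegral do rewrite ggE Kim_real.
  rewrite Rintegral_cst// mul0r; case: (a == b).
    by rewrite mulr1n Kim_real.
  by rewrite mulr0n KpartsE.
pose es z : 'cV[K]_n := \col_(i < n) e i z 0 0.
have esL : L2 Omega es by apply: L2_stack => i; exact: eL.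
have [c [c0 cG]] := left_kernel_vector (gram Omega g es) (ltnSn n).
have [a a0 ca] := unit_vector c0.
set c1 := Kreal a *: c in ca.
have c1G : c1 *m gram Omega g es = 0 by rewrite -scalemxAl cG scaler0.
clearbody c1.
have q0 : Num.sqrt m != 0 by rewrite sqrtr_eq0 -ltNge.
exists (fun z => (Kreal (Num.sqrt m)^-1 *: c1) *m g z); split.
- exact: L2_mulmx.
- rewrite L2inner_gram gram_mulmx// gg adjZ Kconj_real mul_mx_scalar.
  rewrite -!scalemxAl -!scalemxAr ca !mxE eqxx mulr1n mulr1 -!rmorphM/=.
  rewrite [X in Kreal X](_ : _ = 1) ?rmorph1//.
  by rewrite -{1}(sqr_sqrtr (ltW m0)); field.
- move=> i ni; have := congr1 (fun A : 'M[K]_(1, n) => A 0 (Ordinal ni)) c1G.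
  rewrite -gram_mulmxl// => c1Gi.
  rewrite L2inner_gram [gram _ _ _](_ : _ =
      Kreal (Num.sqrt m)^-1 *: gram Omega (fun z => c1 *m g z) (e i)).
    move: c1Gi; rewrite !mxE => c1Gi.
    transitivity (Kreal (Num.sqrt m)^-1 * 0 : K); last by rewrite mulr0.
    congr (_ * _); rewrite -[RHS]c1Gi; congr Kint; apply/funext => z.
    by congr (_ * Kconj _); rewrite /es mxE.
  by rewrite !gram_mulmxl// ?scalemxAl//; exact: eL.
Qed.

End SingularValues.

Section SvdExists.
Context (R : realType) (k : scalars).
Local Notation K := (Kfield R k).
Local Notation mu := (@plane_lebesgue R).
Variable Omega : set R[i].

(** The unitary matrix U that diagonalizes the Gram matrix of h makes the components
of w = U h orthogonal, with squared norms the diagonal entries. Sorted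
decreasingly, these are the squares of the singular values, and the normalized
components are the v_j. The components of norm zero vanish almost everywhere:
the corresponding v_j are arbitrary and come from [L2_extend_orthonormal]. *)
Lemma svd_exists N (h : R[i] -> 'cV[K]_N) : domain Omega -> L2 Omega h ->
  exists u v sigma, is_svd Omega h u v sigma.
Proof.
move=> dO; have [oO _ _] := dO; have mO := measurable_open oO.
case: N h => [|n] h hL.
  exists (fun=> 0), (fun=> fun=> 0), (fun=> 0); split.
  - by case.
  - by split=> -[].
  - by move=> i j; rewrite andbF.
  - by apply: aeW => z _; apply/matrixP => -[].
have hG := gram_adj mO hL hL.
have [U UU /is_diag_mxP dU] := hermitian_diagonalization hG.
have UU' : adj U *m U = 1%:M by exact: mulmx1C.
pose w z := U *m h z.
have wL : L2 Omega w by exact: L2_mulmx.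
pose D := gram Omega w w.
have DE : D = U *m gram Omega h h *m adj U by exact: gram_mulmx.
have D0 i j : i != j -> D i j = 0 by move=> ij; rewrite DE dU.
pose d i := Kre (D i i).
have d0 i : 0 <= d i.
  rewrite /d mxE Kre_int; apply: Rintegral_ge0 => z _.
  by rewrite mulKconj Kre_real addr_ge0 ?sqr_ge0.
have DdE i : D i i = Kreal (d i).
  apply: Kext; rewrite ?Kre_real// Kim_real /D mxE (Kim_int mO).
  under eq_Rintegral do rewrite mulKconj Kim_real.
  by rewrite Rintegral_cst// mul0r.
(* [e] lists the indices by nonincreasing squared norm, and [s i] is the index of
   the component of w that yields the singular value number i. *)
pose e := sort (fun i j => d j <= d i) (enum 'I_n.+1).
have e_size : size e = n.+1 by rewrite size_sort -cardE card_ord.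
have e_uniq : uniq e by rewrite sort_uniq enum_uniq.
have e_mem i : i \in e by rewrite mem_sort mem_enum.
have e_sorted : sorted (fun i j => d j <= d i) e.
  by apply: sort_sorted => i j; exact: le_total.
pose s i := nth ord0 e i.
have s_inj i j : (i < n.+1)%N -> (j < n.+1)%N -> (s i == s j) = (i == j).
  by move=> iN jN; rewrite nth_uniq ?e_size.
have ds i j : (i <= j < n.+1)%N -> d (s j) <= d (s i).
  move=> /andP[ij jN].
  have d_trans : transitive (fun i j => d j <= d i).
    by move=> a b c ab bc; exact: le_trans bc ab.
  have d_refl : reflexive (fun i j => d j <= d i) by move=> a /=; exact: lexx.
  apply: (sorted_leq_nth d_trans d_refl ord0 e_sorted) => //; rewrite inE e_size//.
  exact: leq_ltn_trans jN.
pose sigma i := Num.sqrt (d (s i)).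
have sigma2 i : sigma i ^+ 2 = d (s i) by rewrite sqr_sqrtr.
(* The rank of h: the positions below r carry the nonzero singular values. *)
pose r := find (fun i => d i == 0) e.
have rN : (r <= n.+1)%N by rewrite -e_size find_size.
have lt_r i : (i < r)%N -> sigma i != 0.
  move=> ir; have := before_find ord0 ir; rewrite -/(s i) => /negbT di.
  by rewrite sqrtr_eq0 -ltNge lt_neqAle eq_sym di d0.
have ge_r i : (r <= i < n.+1)%N -> d (s i) = 0.
  move=> /andP[ri iN]; apply/le_anti; rewrite d0 andbT.
  have rN' : has (fun i => d i == 0) e by rewrite has_find e_size (leq_ltn_trans ri).
  by rewrite -(eqP (nth_find ord0 rN')); apply: ds; rewrite ri.
pose B i : 'M[K]_(1, n.+1) := Kreal (sigma i)^-1 *: row (s i) 1%:M.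
pose v0 i z : 'cV[K]_1 := B i *m w z.
have v0E i z : v0 i z 0 0 = Kreal (sigma i)^-1 * w z (s i) 0.
  by rewrite /v0 /B -scalemxAl -row_mul mul1mx !mxE.
have [|||v [vE vL vorth]] := @extend_orthonormal R k _ (L2inner Omega) (L2 Omega (m := 1))
    n.+1 r v0 _ _ rN (fun i _ => L2_mulmx mO (B i) wL).
- move=> x y xL yL; rewrite !L2inner_gram => xy.
  by rewrite -(gram_adj mO yL xL) adjE xy raddf0.
- by move=> m f mn fL; exact: L2_extend_orthonormal.
- move=> i j ir jr; rewrite L2inner_gram gram_mulmx// -/D.
  rewrite /B adjZ Kconj_real -!scalemxAl -scalemxAr.
  rewrite -row_mul mul1mx (_ : (row (s i) D *m adj (row (s j) 1%:M)) =
    (D (s i) (s j))%:M); last first.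
    apply/matrixP => a b; rewrite !ord1 !mxE eqxx mulr1n (bigD1 (s j))//=.
    rewrite !mxE eqxx rmorph1 mulr1 big1 ?addr0// => l /negbTE lj.
    by rewrite !mxE eq_sym lj raddf0 mulr0.
  rewrite mxE [X in _ * X]mxE [X in _ * (_ * X)]mxE eqxx mulr1n.
  rewrite -(s_inj i j) ?(leq_trans ir)// ?(leq_trans jr)//.
  have [sij|sij] := eqVneq (s i) (s j); last by rewrite D0// !mulr0.
  have -> : j = i by apply/eqP; rewrite eq_sym -(s_inj i j) ?sij ?(leq_trans ir) ?(leq_trans jr).
  rewrite DdE -sigma2 -!rmorphM/= [X in Kreal X](_ : _ = 1) ?rmorph1//.
  by have := lt_r i ir => si; field.
pose u (i : 'I_n.+1) : 'cV[K]_n.+1 := col (s i) (adj U).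
exists u, (fun i => v i), sigma; split.
- move=> i j.
  transitivity (Kconj ((U *m adj U) (s i) (s j))).
    rewrite mxE rmorph_sum/=; apply: eq_bigr => l _.
    by rewrite /u !mxE KconjM KconjK.
  rewrite UU mxE s_inj// val_eqE; case: (i == j).
    by rewrite mulr1n rmorph1.
  by rewrite mulr0n raddf0.
- by split=> [j|i j]; [exact: vL|exact: vorth].
- by move=> i j ij; rewrite sqrtr_ge0/= ler_sqrt//; exact: ds.
- have wae : {ae mu, forall z, forall i : 'I_n.+1, Omega z -> (r <= i)%N -> w z (s i) 0 = 0}.
    apply: filter_forall => i; have [ri|ri] := leqP r i; last first.
      by apply: aeW.
    have := gram_diag_eq0 mO (i := s i) wL.
    rewrite -/D -/(d (s i)) ge_r ?ri//= => /(_ erefl).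
    by apply: filterS => z hz Oz _; exact: hz.
  apply: filterS wae => z wz Oz.
  have -> : h z = adj U *m w z by rewrite /w mulmxA UU' mul1mx.
  apply/matrixP => a b; rewrite ord1 summxE mxE.
  rewrite (reindex_inj (h := fun i : 'I_n.+1 => s i)); last first.
    by move=> i j /eqP; rewrite s_inj// => /eqP/val_inj.
  apply: eq_bigr => i _; rewrite [RHS]mxE [u i a 0]mxE mulrC; congr (_ * _).
  have [ri|ir] := leqP r i.
    rewrite wz// (_ : sigma i = 0) ?raddf0 ?mul0r//.
    by rewrite /sigma ge_r ?sqrtr0// ri/=.
  rewrite vE// v0E mulrA -rmorphM/= mulfV ?lt_r// rmorph1 mul1r//.
Qed.

Lemma singular_value_svd N (h : R[i] -> 'cV[K]_N) (j : nat) :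
  domain Omega -> L2 Omega h ->
  exists u v sigma, is_svd Omega h u v sigma /\
    singular_value Omega h j = sigma j.
Proof.
move=> dO hL; have [u [v [sigma hs]]] := svd_exists dO hL.
apply: (@getPex _ [set s | exists u v sigma, is_svd Omega h u v sigma /\ s = sigma j]).
by exists (sigma j), u, v, sigma.
Qed.

End SvdExists.

(** If sigma_0 vanished, so would all the smaller singular values, and h with
them. *)
Lemma svd_leading (R : realType) (k : scalars) (Omega : set R[i]) n
    (h : R[i] -> 'cV[Kfield R k]_n.+1) :
  domain Omega -> L2 Omega h -> ~ aeeq Omega h (fun=> 0) ->
  exists u v sigma, [/\ is_svd Omega h u v sigma, 0 < sigma 0 &
    singular_value Omega h 0 = sigma 0].
Proof.
move=> dO hL h0; have [u [v [sigma [hs s0E]]]] := singular_value_svd 0 dO hL.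
exists u, v, sigma; split => //.
have [_ _ smono hE] := hs.
rewrite lt_neqAle; have /andP[-> _] := smono 0 0 isT; rewrite andbT.
apply/eqP => s00; apply: h0; apply: filterS hE => z hz Oz; rewrite hz//.
apply: big1 => j _; have := smono 0 j (ltn_ord j); rewrite -s00 -eq_le => /eqP <-.
by rewrite (_ : Kreal 0 = 0) ?mul0r ?scale0r//; apply: Kext; rewrite !KpartsE.
Qed.

Lemma L2norm_svd (R : realType) (k : scalars) (Omega : set R[i]) N
    (h : R[i] -> 'cV[Kfield R k]_N) u v sigma :
  measurable Omega -> L2 Omega h -> is_svd Omega h u v sigma ->
  L2norm Omega h ^+ 2 = \sum_(j < N) sigma j ^+ 2.
Proof.
move=> mO hL hs; have := svd_norm mO 1%:M hL hs.
have -> : (fun z => 1%:M *m h z) = h by apply/funext => z; rewrite mul1mx.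
move=> ->; apply: eq_bigr => j _; rewrite mul1mx norm2_sqE -[RHS]mulr1.
have [uorth _ _ _] := hs; congr (_ * _).
have := congr1 Kre (uorth j j); rewrite eqxx raddf_sum => /= ->.
by rewrite -(@Kreal1 R k) Kre_real.
Qed.

(** * Real coordinates of a Gaussian matrix *)

Lemma Kmk01_real (R : realType) (k : scalars) :
  k = RealScalars -> Kmk 0 1 = 0 :> Kfield R k.
Proof. by move=> ->. Qed.

Lemma complex_part_isometry (R : realType) (k : scalars)
    (x y j : Kfield R k) (b c : bool) : Kre j = 0 -> Kim j = 1 ->
  (if b then Kre x else Kim x) * (if c then Kre y else Kim y) +
  (if b then Kre (x * j) else Kim (x * j)) *
    (if c then Kre (y * j) else Kim (y * j)) =
  (if b then Kre (x * Kconj y * (if c then 1 else j))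
        else Kim (x * Kconj y * (if c then 1 else j))).
Proof. by move=> rj ij; case: b; case: c; rewrite !KpartsE ?rj ?ij; ring. Qed.

Section RealCoordinates.
Context (R : realType) (k : scalars).
Local Notation K := (Kfield R k).

(** The real coordinates of a scalar are indexed by 'I_(Kdim k), one over the reals
and two over the complex numbers, so that both cases are treated at once. *)
Definition part (b : 'I_(Kdim k)) (x : K) : R := if b == 0%N :> nat then Kre x else Kim x.

(** The real basis dual to the coordinates [part]: 1, and also i over the complex
numbers. *)
Definition unit_part (b : 'I_(Kdim k)) : K := if b == 0%N :> nat then 1 else Kmk 0 1.

(** A sum over the coordinates written as two terms whatever the field; over the
reals the second one must vanish. *)
Lemma sum_parts (F : 'I_(Kdim k) -> R) (G : nat -> R) :
  (forall b, F b = G b) -> (k = RealScalars -> G 1%N = 0) ->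
  \sum_b F b = G 0%N + G 1%N.
Proof.
move=> FG G1; rewrite (eq_bigr (fun b => G (val b))) => [|b _]; last by rewrite FG.
move: G1 {F FG}; rewrite /Kdim; case: k => /= G1.
  by rewrite big_ord_recl big_ord0 G1.
by rewrite !big_ord_recl big_ord0/= addr0.
Qed.

Lemma sum_part_sqr (x : K) : \sum_b part b x ^+ 2 = Kre x ^+ 2 + Kim x ^+ 2.
Proof.
rewrite (@sum_parts _ (fun b => (if b == 0%N then Kre x else Kim x) ^+ 2))//.
by move=> kR; move: x; rewrite kR => x /=; rewrite expr0n.
Qed.

Lemma partD b : {morph part b : x y / x + y}.
Proof. by move=> x y; rewrite /part; case: ifP => _; rewrite KpartsE. Qed.

Lemma part0 b : part b 0 = 0.
Proof. by rewrite /part; case: ifP => _; rewrite KpartsE. Qed.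

Lemma part_sum b (I : finType) (F : I -> K) :
  part b (\sum_i F i) = \sum_i part b (F i).
Proof. exact: (big_morph _ (partD b) (part0 b)). Qed.

Lemma part_unit b c : part b (unit_part c) = (b == c)%:R.
Proof.
rewrite -val_eqE /part /unit_part; case: b c => [b bk] [c ck] /=.
have: k = RealScalars -> b = 0%N /\ c = 0%N.
  by move=> kR; move: bk ck; rewrite kR; case: b c => [|b] [|c].
move: bk ck; rewrite /Kdim; case: k => /= bk ck h.
  by have [-> ->] := h erefl; rewrite eqxx.
by move: bk ck {h}; case: b => [|[|b]]; case: c => [|[|c]].
Qed.

(** Multiplication by x is real-linear; its matrix has entry
[part b (x * unit_part c)] in row b and column c. *)
Lemma part_mul b (x y : K) :
  part b (x * y) = \sum_c part b (x * unit_part c) * part c y.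
Proof.
have {1}-> : y = \sum_c Kreal (part c y) * unit_part c.
  apply: Kext.
    rewrite raddf_sum/= (@sum_parts _ (fun c => if c == 0%N then Kre y else 0)) ?addr0//.
    move=> c; rewrite KreM Kre_real Kim_real mul0r subr0 /part /unit_part.
    by case: ifP => _; rewrite ?KpartsE ?mulr1//; case: k y c => /= *; rewrite ?mulr0 ?mul0r.
  rewrite raddf_sum/= (@sum_parts _ (fun c => if c == 0%N then 0 else Kim y)) ?add0r//.
    move=> c; rewrite KimM Kre_real Kim_real mul0r addr0 /part /unit_part.
    by case: ifP => _; rewrite ?KpartsE ?mulr0//; case: k y c => /= *; rewrite ?mulr1 ?mul0r.
  by move=> kR; move: y; rewrite kR.
rewrite mulr_sumr part_sum; apply: eq_bigr => c _.
by rewrite /part; do 2!case: ifP => _; rewrite !KpartsE; ring.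
Qed.

(** The matrix of multiplication by x, times the transpose of the matrix of
multiplication by y, is the matrix of multiplication by x y^*. This carries
complex orthonormality over to the real coordinates. *)
Lemma part_isometry b c (x y : K) :
  \sum_e part b (x * unit_part e) * part c (y * unit_part e) =
  part b (x * Kconj y * unit_part c).
Proof.
rewrite (@sum_parts _ (fun e => part b (x * (if e == 0%N then 1 else Kmk 0 1)) *
  part c (y * (if e == 0%N then 1 else Kmk 0 1))))//=; last first.
  by move=> kR; rewrite (Kmk01_real R kR) mulr0 part0 mul0r.
rewrite /part /unit_part !mulr1; case: b c => [b bk] [c ck] /=.
move: x y bk ck; rewrite /Kdim; case: k => x y bk ck.
  have -> : b = 0%N by case: b bk.
  have -> /= : c = 0%N by case: c ck.
  by rewrite !mulr0 addr0 mulr1.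
exact: (@complex_part_isometry R ComplexScalars x y (Kmk 0 1) (b == 0%N) (c == 0%N)).
Qed.

End RealCoordinates.

Lemma sum_triple (V : nmodType) (A B C : finType) (F : A * B * C -> V) :
  \sum_q F q = \sum_a \sum_b \sum_c F (a, b, c).
Proof.
rewrite pair_bigA/= pair_bigA/=; apply: eq_bigr.
by case=> [[a b] c].
Qed.

Section GaussianMatrixCoordinates.
Context (R : realType) (k : scalars) (N l : nat).
Local Notation K := (Kfield R k).
Local Notation index := ('I_N * 'I_l * 'I_(Kdim k))%type.

Definition matrix_coord (Y : 'M[K]_(N, l)) (q : index) : R :=
  part q.2 (Y q.1.1 q.1.2).

(** Row p = (i, j, b) lists the weights of the real coordinates of Y in coordinate b
of entry j of Y^T u_i; see [rotation_weightE]. For orthonormal u_i this real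
matrix is orthogonal. *)
Definition rotation_weight (u : 'I_N -> 'cV[K]_N) (p q : index) : R :=
  (p.1.2 == q.1.2)%:R * part p.2 (u p.1.1 q.1.1 0 * unit_part R q.2).

Lemma rotation_weightE (u : 'I_N -> 'cV[K]_N) (Y : 'M[K]_(N, l)) p :
  \sum_q rotation_weight u p q * matrix_coord Y q =
  part p.2 ((Y^T *m u p.1.1) p.1.2 0).
Proof.
rewrite sum_triple mxE part_sum; apply: eq_bigr => n _.
rewrite (bigD1 p.1.2)//= [X in _ + X]big1 ?addr0 => [|j /negbTE jp]; last first.
  by rewrite big1// => b _; rewrite /rotation_weight/= eq_sym jp !mul0r.
rewrite mxE mulrC part_mul; apply: eq_bigr => b _.
by rewrite /rotation_weight/= eqxx mul1r.
Qed.

Lemma norm2_sq_parts m (y : 'cV[K]_m) :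
  norm2_sq y = \sum_j \sum_(b < Kdim k) part b (y j 0) ^+ 2.
Proof. by apply: eq_bigr => j _; rewrite sum_part_sqr. Qed.

Variable u : 'I_N -> 'cV[K]_N.
Hypothesis uorth : forall i j, \sum_n u i n 0 * Kconj (u j n 0) = (i == j)%:R.

Lemma rotation_weight_orthonormal p p' :
  \sum_q rotation_weight u p q * rotation_weight u p' q = (p == p')%:R.
Proof.
case: p p' => [[i j] b] [[i' j'] b']; rewrite sum_triple exchange_big/=.
rewrite (bigD1 j)//= [X in _ + X]big1 ?addr0 => [|j2 /negbTE jj]; last first.
  rewrite big1// => n _; rewrite big1// => c _.
  by rewrite /rotation_weight/= eq_sym jj !mul0r.
rewrite /rotation_weight/= eqxx.
under eq_bigr => n _.
  under eq_bigr => c _ do rewrite mul1r mulrCA.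
  rewrite -mulr_sumr part_isometry; over.
rewrite -mulr_sumr -part_sum -mulr_suml uorth [j' == j]eq_sym !xpair_eqE.
case: (i == i') => /=; last by rewrite mul0r part0 mulr0.
by rewrite mul1r part_unit -natrM mulnb.
Qed.

(** An orthogonal square matrix preserves the norm of the vector x. To avoid a real
matrix indexed by triples, x is packed into the matrix Y over K of which it lists
the real coordinates, and the matrix with rows u_i, which is unitary, is applied
to Y. *)
Lemma rotation_weight_complete (x : index -> R) :
  \sum_p (\sum_q rotation_weight u p q * x q) ^+ 2 = \sum_q x q ^+ 2.
Proof.
pose Y : 'M[K]_(N, l) := \matrix_(n, j) \sum_b Kreal (x (n, j, b)) * unit_part R b.
have xE q : x q = matrix_coord Y q.
  case: q => [[n j] b]; rewrite /matrix_coord mxE part_sum (bigD1 b)//=.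
  have pr a c : part b (Kreal a * unit_part R c) = a * (b == c)%:R :> R.
    by rewrite -part_unit /part; case: ifP => _; rewrite !KpartsE; ring.
  rewrite pr eqxx mulr1 big1 ?addr0// => c /negbTE cb.
  by rewrite pr eq_sym cb mulr0.
under eq_bigr => p _.
  under eq_bigr do rewrite xE.
  rewrite rotation_weightE; over.
under [RHS]eq_bigr do rewrite xE.
rewrite !sum_triple/=.
transitivity (\sum_i norm2_sq (Y^T *m u i)).
  by apply: eq_bigr => i _; rewrite norm2_sq_parts.
pose Um : 'M[K]_N := \matrix_(i, n) u i n 0.
have UU : adj Um *m Um = 1%:M.
  apply: mulmx1C; apply/matrixP => i j; rewrite !mxE -uorth.
  by apply: eq_bigr => n _; rewrite adjE !mxE.
pose Z := Um *m Y.
transitivity (\sum_j Kre ((adj Z *m Z) j j)).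
  rewrite exchange_big/=; apply: eq_bigr => j _.
  rewrite -{2}[Z]adjK mulmx_adj_diag Kre_real; apply: eq_bigr => i _.
  have -> : (Y^T *m u i) j 0 = Z i j.
    by rewrite !mxE; apply: eq_bigr => n _; rewrite !mxE mulrC.
  by rewrite adjE !KpartsE sqrrN.
rewrite /Z adjM mulmxA -[adj Y *m _ *m _]mulmxA UU mulmx1.
rewrite [RHS]exchange_big/=; apply: eq_bigr => j _.
rewrite -{2}[Y]adjK mulmx_adj_diag Kre_real; apply: eq_bigr => n _.
by rewrite /matrix_coord/= sum_part_sqr adjE !KpartsE sqrrN.
Qed.

Context d (T : measurableType d) (P : probability T R) (Vt : T -> 'M[K]_(N, l)).
Hypothesis gV : gaussian_matrix P Vt.

Lemma gaussian_coord_normal q : standard_normal P (fun t => matrix_coord (Vt t) q).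
Proof.
case: q => [[n j] b]; have := gV.1 n j; rewrite /matrix_coord/= /part.
move: b (Vt); rewrite /Kdim; case: k => b V /=.
  by case: b => [[|b]].
by case: b => [[|[|b]]]//= _ [].
Qed.

Let prod_setT (I : finType) (F : I -> \bar R) :
  (\prod_(i in [set: I]%SET) F i = \prod_i F i)%E.
Proof. by apply: eq_bigl => i; rewrite inE. Qed.

Lemma gaussian_entry_independent n j (B : 'I_(Kdim k) -> set R) :
  (forall b, measurable (B b)) ->
  P [set t | forall b, B b (matrix_coord (Vt t) (n, j, b))] =
  (\prod_b P ((fun t => matrix_coord (Vt t) (n, j, b)) @^-1` B b))%E.
Proof.
have := gV.1 n j; rewrite /matrix_coord/= /part.
move: (Vt) B; rewrite /Kdim; case: k => V B /=.
  move=> _ mB; rewrite big_ord_recl big_ord0 mule1; congr (P _).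
  apply/seteqP; split => t /= h; first exact: (h ord0).
  by move=> b; rewrite (ord1 b).
move=> [_ _ ind] mB.
pose B' (b : bool) := if b then B (lift ord0 ord0) else B ord0.
have mB' b : measurable (B' b) by case: b; exact: mB.
have := ind [set: bool]%SET B' mB'.
rewrite prod_setT big_bool/= muleC !big_ord_recl big_ord0 mule1 => <-; congr (P _).
apply/seteqP; split => t /= h.
  by case=> _; [exact: (h (lift ord0 ord0))|exact: (h ord0)].
move=> b; have hb c : B' c (if c then complex.Im (V t n j) else complex.Re (V t n j)).
  by apply: h; rewrite /= ?inE.
case: (unliftP ord0 b) => [b' ->|->]; last exact: (hb false).
by rewrite (ord1 b'); exact: (hb true).
Qed.

(** Independence of the entries, as points of the plane, combined with independence
of the parts of each entry: the conditions on the coordinates of one entry cut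
out a measurable subset of the plane. *)
Lemma gaussian_coord_independent (B : index -> set R) :
  (forall q, measurable (B q)) ->
  P [set t | forall q, B q (matrix_coord (Vt t) q)] =
  (\prod_q P ((fun t => matrix_coord (Vt t) q) @^-1` B q))%E.
Proof.
move=> mB.
pose proj (b : 'I_(Kdim k)) (p : R * R) := if b == 0%N :> nat then p.1 else p.2.
pose C (nj : 'I_N * 'I_l) : set (R * R) :=
  \bigcap_(b in [set: 'I_(Kdim k)]) (proj b @^-1` B (nj.1, nj.2, b)).
have mC nj : measurable (C nj).
  apply: fin_bigcap_measurable => [|b _]; first exact: finite_finset.
  rewrite -[X in measurable X]setTI /proj; case: (b == 0%N :> nat).
    by apply: (@measurable_fst _ _ R R).
  by apply: (@measurable_snd _ _ R R).
have CE nj t : C nj (Kre (Vt t nj.1 nj.2), Kim (Vt t nj.1 nj.2)) <->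
    forall b, B (nj.1, nj.2, b) (matrix_coord (Vt t) (nj.1, nj.2, b)).
  rewrite /C /proj /matrix_coord /part /=; split => [h b|h b _] /=.
    by have := h b Logic.I; rewrite /=; case: ifP.
  by have := h b; case: ifP.
have := gV.2 [set: 'I_N * 'I_l]%SET C mC; rewrite prod_setT.
rewrite [X in P X = _ -> _](_ : _ = [set t | forall q, B q (matrix_coord (Vt t) q)]).
  move=> ->.
  pose F nj b := P ((fun t => matrix_coord (Vt t) (nj, b)) @^-1` B (nj, b)).
  transitivity (\prod_nj \prod_b F nj b)%E.
    apply: eq_bigr => -[n j] _; rewrite -gaussian_entry_independent//.
    by congr (P _); apply/seteqP; split => t ht; apply/(CE (n, j) t).
  by rewrite pair_bigA/=; apply: eq_bigr => -[nj b] _.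
apply/seteqP; split => t /= h.
  move=> [[n j] b]; apply: (CE (n, j) t).1.
  by apply: h; rewrite /= inE.
by move=> nj _; apply: (CE nj t).2 => b; exact: h.
Qed.

(** The energies ||V^T u_i||^2 have the joint moment generating function of
independent chi-square variables with l (Kdim k) degrees of freedom: each is
the sum of the squares of the coordinates (i, j, b) of an orthogonal transform
of the coordinates of V, so [gaussian_quadratic_expectation] applies with
coefficients that depend on i only. *)
Lemma gaussian_matrix_mgf (c : 'I_N -> R) : (forall i, c i < 1) ->
  (\int[P]_t (expR (\sum_i c i * norm2_sq ((Vt t)^T *m u i) / 2))%:E =
   (\prod_i (Num.sqrt (1 - c i))^-1 ^+ (l * Kdim k))%:E)%E.
Proof.
move=> c1.
have := gaussian_quadratic_expectation (c := fun p : index => c p.1.1)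
  gaussian_coord_normal gaussian_coord_independent rotation_weight_orthonormal
  rotation_weight_complete (fun p => c1 p.1.1).
rewrite [X in _ = (X%:E)%E -> _](_ : _ = \prod_i (Num.sqrt (1 - c i))^-1 ^+ (l * Kdim k)); last first.
  transitivity (\prod_(p : 'I_N * ('I_l * 'I_(Kdim k))) (Num.sqrt (1 - c p.1))^-1).
    rewrite (reindex (fun p : 'I_N * ('I_l * 'I_(Kdim k)) => (p.1, p.2.1, p.2.2)))//=.
    by exists (fun p => (p.1.1, (p.1.2, p.2))); [case=> a [b e]|case=> [[a b] e]].
  rewrite -(pair_bigA _ (fun i _ => (Num.sqrt (1 - c i))^-1))/=.
  by apply: eq_bigr => i _; rewrite prodr_const card_prod !card_ord.
move=> <-; apply: eq_integral => t _; congr (expR _)%:E.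
under [RHS]eq_bigr do rewrite rotation_weightE.
rewrite sum_triple/=; apply: eq_bigr => i _.
rewrite norm2_sq_parts -mulrA mulrC mulr_suml mulr_suml.
apply: eq_bigr => j _; rewrite !mulr_suml; apply: eq_bigr => b _.
by ring.
Qed.

End GaussianMatrixCoordinates.

(** * Tails of weighted sums of chi-square variables *)

(** Convexity of the exponential between 0 and a, obtained from its tangent at the
intermediate point r a. *)
Lemma expR_chord (R : realType) (a r : R) : 0 <= r <= 1 ->
  expR (r * a) <= r * expR a + (1 - r).
Proof.
move=> /andP[r0 r1].
have e0 : 0 < expR (r * a) by exact: expR_gt0.
have h1 : expR (r * a) * (1 + (1 - r) * a) <= expR a.
  have -> : expR a = expR (r * a) * expR ((1 - r) * a).
    by rewrite -expRD; congr expR; ring.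
  by rewrite ler_pM2l// expR_ge1Dx.
have h2 : expR (r * a) * (1 + - (r * a)) <= 1.
  by rewrite -[leRHS]expR0 -(subrr (r * a)) expRD ler_pM2l// expR_ge1Dx.
nra.
Qed.

(** With y = 1 - tau^(-2), the claim (1 - r y)^(-1/2) <= tau^r says that
tau^(- 2 r) <= 1 - r y, which is [expR_chord] for a = - 2 ln tau; equality holds
at r = 0 and r = 1. *)
Lemma chi_square_mgf_bound (R : realType) (r tau : R) : 0 <= r <= 1 -> 1 < tau ->
  (Num.sqrt (1 - r * (1 - tau ^- 2)))^-1 <= expR (r * ln tau).
Proof.
move=> r01 tau1; have tau0 : 0 < tau by exact: lt_trans tau1.
have e2 : expR (- 2 * ln tau) = tau ^- 2.
  by rewrite mulNr expRN mulrC expRM_natr lnK// posrE.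
have h : expR (- 2 * (r * ln tau)) <= 1 - r * (1 - tau ^- 2).
  have -> : - 2 * (r * ln tau) = r * (- 2 * ln tau) by ring.
  by apply: le_trans (expR_chord _ r01) _; rewrite e2; lra.
rewrite -[leRHS]invrK -expRN lef_pV2 ?posrE ?expR_gt0//; last first.
  by rewrite sqrtr_gt0 (lt_le_trans _ h)// expR_gt0.
rewrite -[leLHS]gtr0_norm ?expR_gt0// -sqrtr_sqr ler_sqrt; last first.
  by rewrite (le_trans _ h)// expR_ge0.
by rewrite -expRM_natl; apply: le_trans h; rewrite mulrN mulNr.
Qed.

Section WeightedChiSquare.
Context (R : realType) (k : scalars) (n l : nat).
Local Notation K := (Kfield R k).
Local Notation M := ((Kdim k)%:R * l%:R : R).
Variable u : 'I_n.+1 -> 'cV[K]_n.+1.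
Hypothesis uorth : forall i j, \sum_a u i a 0 * Kconj (u j a 0) = (i == j)%:R.
Context d (T : measurableType d) (P : probability T R)
  (Vt : T -> 'M[K]_(n.+1, l)).
Hypothesis gV : gaussian_matrix P Vt.
Hypothesis l0 : (0 < l)%N.

Definition energy i t : R := norm2_sq ((Vt t)^T *m u i).

Lemma energy_ge0 i t : 0 <= energy i t.
Proof. exact: norm2_sq_ge0. Qed.

Lemma measurable_energy i : measurable_fun setT (energy i).
Proof.
rewrite (_ : energy i = fun t => \sum_j \sum_b
    (\sum_q rotation_weight u (i, j, b) q * matrix_coord (Vt t) q) ^+ 2).
  do 2!(apply: measurable_sum => ?); apply: measurable_funX.
  apply: measurable_sum => q; apply: measurable_funM => //.
  exact: (gaussian_coord_normal gV q).1.
apply/funext => t; rewrite /energy norm2_sq_parts.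
apply: eq_bigr => j _; apply: eq_bigr => b _.
by rewrite rotation_weightE.
Qed.

Let M0 : 0 < M.
Proof. by rewrite -natrM ltr0n muln_gt0 l0 andbT; case: k. Qed.

(** The moment generating function with the single nonzero coefficient - p gives
E exp(- p Y_0 / 2) = (1 + p)^(- M / 2), the Laplace transform of the Gamma law of
shape M / 2. *)
Lemma energy_lower_tail (x : R) : 0 < x ->
  (P [set t | (energy ord0 t / 2 <= x)%R] <=
    ((Gamma (M / 2))^-1 * lower_gamma (M / 2) x)%:E)%E.
Proof.
move=> x0; apply: gamma_law_lower_tail => //.
- by apply: measurable_funM => //; exact: measurable_energy.
- by move=> t; rewrite divr_ge0 ?energy_ge0.
- by rewrite divr_gt0.
move=> p; pose c (i : 'I_n.+1) : R := if i == ord0 then - p%:R else 0.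
have c1 i : c i < 1.
  by rewrite /c; case: ifP => // _; rewrite (le_lt_trans _ ltr01)// oppr_le0.
transitivity (\int[P]_t (expR (\sum_i c i * energy i t / 2))%:E)%E.
  apply: eq_integral => t _; congr (expR _)%:E.
  rewrite (bigD1 ord0)//= big1 ?addr0 => [|i i0]; last first.
    by rewrite /c (negbTE i0) !mul0r.
  by rewrite /c eqxx; ring.
rewrite gaussian_matrix_mgf//; congr EFin.
rewrite (bigD1 ord0)//= big1 ?mulr1 => [|i i0]; last first.
  by rewrite /c (negbTE i0) subr0 sqrtr1 invr1 expr1n.
rewrite /c eqxx opprK -powR12_sqrt ?addr_ge0// -powRN -powR_mulrn ?powR_ge0//.
rewrite -powRrM; congr (_ `^ _).
by rewrite natrM; field.
Qed.

(** Chernoff bound for sum_i r_i Y_i. The parameter y = 1 - tau^(-2) is the optimal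
one for a single weight r = 1, and [chi_square_mgf_bound] shows that smaller
weights only contribute in proportion, so the total weight rho takes the place
of the number of variables. *)
Lemma energy_upper_tail (r : 'I_n.+1 -> R) (tau : R) :
  (forall i, 0 <= r i <= 1) -> 1 < tau ->
  (P [set t | (M * (\sum_i r i) * tau ^+ 2 <= \sum_i r i * energy i t)%R] <=
    (expR (- (M / 2) * ((\sum_i r i) * (tau - 1) ^+ 2)))%:E)%E.
Proof.
move=> r01 tau1; have tau0 : 0 < tau by exact: lt_trans tau1.
set rho := \sum_i r i.
have rho0 : 0 <= rho by apply: sumr_ge0 => i _; have /andP[] := r01 i.
pose y := 1 - tau ^- 2.
have tau2 : tau ^- 2 < 1 by rewrite invf_lt1 ?exprn_gt0// exprn_egt1.
have y0 : 0 < y by rewrite subr_gt0.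
have y1 : y < 1 by rewrite /y ltrBlDr ltrDl invr_gt0 exprn_gt0.
have ry i : r i * y < 1.
  have /andP[ri0 ri1] := r01 i.
  by rewrite (le_lt_trans _ y1)// ler_piMl// ltW.
pose S t := \sum_i r i * energy i t.
have mS : measurable_fun setT S.
  by apply: measurable_sum => i; apply: measurable_funM => //; exact: measurable_energy.
pose q := M * rho * tau ^+ 2.
have mE : measurable [set t | q <= S t].
  rewrite [X in measurable X](_ : _ = setT `&` S @^-1` ([set` `[q, +oo[] : set R)).
    by apply: mS => //; exact: measurable_itv.
  by rewrite setTI; apply/seteqP; split => t /=; rewrite in_itv/= andbT.
have -> : [set t | (M * rho * tau ^+ 2 <= \sum_i r i * energy i t)%R] = [set t | q <= S t].
  by [].
have mexp : measurable_fun setT (fun t => expR (\sum_i (r i * y) * energy i t / 2)).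
  apply: measurableT_comp => //; apply: measurable_sum => i.
  by apply: measurable_funM => //; apply: measurable_funM => //; exact: measurable_energy.
apply: (@le_trans _ _ (\int[P]_t ((expR (- (y * q / 2)))%:E *
    (expR (\sum_i (r i * y) * energy i t / 2))%:E))%E).
  rewrite -[X in (P X <= _)%E]setIT -integral_indic//.
  apply: ge0_le_integral => //.
  - exact/measurable_EFinP/measurable_indic.
  - by apply: emeasurable_funM => //; exact/measurable_EFinP.
  move=> t _; rewrite -EFinM -expRD lee_fin indicE.
  have [qS|_] := boolP (t \in _); last by rewrite expR_ge0.
  rewrite -[leLHS]expR0 ler_expR.
  have -> : \sum_i r i * y * energy i t / 2 = y * S t / 2.
    by rewrite /S mulr_sumr mulr_suml; apply: eq_bigr => i _; ring.
  rewrite addrC -mulrBl -mulrBr divr_ge0// mulr_ge0 ?(ltW y0)// subr_ge0.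
  by move: qS; rewrite inE.
rewrite ge0_integralZl_fin ?expR_ge0//.
rewrite gaussian_matrix_mgf// -EFinM lee_fin.
apply: (@le_trans _ _ (expR (- (y * q / 2)) * expR (M * rho * ln tau))).
  rewrite ler_wpM2l ?expR_ge0//.
  apply: (@le_trans _ _ (\prod_i expR (r i * ln tau) ^+ (l * Kdim k))).
    apply: ler_prod => i _; rewrite exprn_ge0 ?invr_ge0 ?sqrtr_ge0//=.
    by rewrite lerXn2r ?nnegrE ?invr_ge0 ?sqrtr_ge0 ?expR_ge0// chi_square_mgf_bound.
  rewrite prodrXl -expR_sum -mulr_suml -/rho -expRM_natl natrM.
  by rewrite le_eqVlt; apply/orP; left; apply/eqP; congr expR; ring.
rewrite -expRD ler_expR.
have lntau : ln tau <= tau - 1.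
  by rewrite -[X in ln X](subrKC 1) le_ln1Dx//; lra.
have yq : y * q = M * rho * (tau ^+ 2 - 1).
  by rewrite /y /q; field; rewrite gt_eqF.
rewrite yq.
have Mr : 0 <= M * rho by rewrite mulr_ge0// ltW.
have := ler_wpM2l Mr lntau.
rewrite -subr_ge0 => h; rewrite -subr_ge0.
have -> : - (M / 2) * (rho * (tau - 1) ^+ 2) -
   (- (M * rho * (tau ^+ 2 - 1) / 2) + M * rho * ln tau) =
   M * rho * (tau - 1) - M * rho * ln tau by field.
exact: h.
Qed.

End WeightedChiSquare.

(** * The sketched error *)

Lemma norm2_sqZ (R : realType) (k : scalars) m (a : R) (v : 'cV[Kfield R k]_m) :
  norm2_sq (Kreal a *: v) = a ^+ 2 * norm2_sq v.
Proof.
rewrite /norm2_sq mulr_sumr; apply: eq_bigr => i _.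
by rewrite mxE !KpartsE; ring.
Qed.

(** For the padded matrix B' = [B 0]^T of size N, padding B^T f with zeros gives
B' f, and A (B' f) = B' (A f) almost everywhere; dropping the zeros leaves
B^T (A f). *)
Lemma sketched_errorE (R : realType) (k : scalars) (Omega : set R[i]) N l
    (W : set (R[i] -> 'cV[Kfield R k]_N)) A f (B : 'M[Kfield R k]_(N, l)) :
  measurable Omega -> (l <= N)%N ->
  L2subspace Omega W -> L2operator Omega W A ->
  commutes_with_linear_maps Omega W A -> W f ->
  L2norm Omega (fun z => B^T *m f z - short_op A (fun y => B^T *m f y) z) =
  L2norm Omega (fun z => B^T *m (f z - A f z)).
Proof.
move=> mO lN [WL _ _ _] [AL _] comm Wf.
pose B' : 'M[Kfield R k]_N := pid_mx l *m B^T.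
have [WB AB] := comm f B' Wf.
have BE : (fun y => pid_mx l *m (B^T *m f y)) = (fun y => B' *m f y) :> (R[i] -> _).
  by apply/funext => y; rewrite mulmxA.
have pidl : pid_mx l *m B' = B^T.
  rewrite mulmxA mul_pid_mx minnn (minn_idPr lN) pid_mx_1 mul1mx//.
apply: L2norm_ae => //.
- apply: L2_sub => //; first by apply: L2_mulmx => //; exact: WL.
  by rewrite /short_op BE; apply: L2_mulmx => //; exact: AL.
- apply: L2_mulmx => //; apply: L2_sub => //; first exact: WL.
  exact: AL.
apply: filterS AB => z ABz Oz.
by rewrite /short_op BE ABz// mulmxA pidl mulmxBr.
Qed.

Theorem theorem3p2 (R : realType) (k : scalars) (Omega : set R[i])
  (N l : nat) (W : set (R[i] -> 'cV[Kfield R k]_N))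
  (A : (R[i] -> 'cV[Kfield R k]_N) -> (R[i] -> 'cV[Kfield R k]_N))
  (f : R[i] -> 'cV[Kfield R k]_N)
  (d : measure_display) (T : measurableType d) (P : probability T R)
  (Vt : T -> 'M[Kfield R k]_(N, l)) (tau : R) :
  domain Omega ->
  (1 <= N)%N -> (1 <= l <= N)%N ->
  L2subspace Omega W ->
  L2operator Omega W A ->
  commutes_with_linear_maps Omega W A ->
  W f ->
  ~ aeeq Omega (fun z => f z - A f z) (fun=> 0) ->
  gaussian_matrix P Vt ->
  1 < tau ->
  let c : R := (Kdim k)%:R in
  let rho := stable_rank Omega (fun z => f z - A f z) in
  let V t := Kreal (Num.sqrt (c * l%:R))^-1 *: Vt t in
  let VTf t z := (V t)^T *m f z in
  let error := L2norm Omega (fun z => f z - A f z) in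
  let sketched_error t :=
    L2norm Omega (fun z => VTf t z - short_op A (VTf t) z) in
  (P [set t | (error >= tau * sketched_error t)%R] <=
     ((Gamma (c * l%:R / 2))^-1 *
      lower_gamma (c * l%:R / 2) (c * l%:R * rho * tau ^- 2 / 2))%:E)%E /\
  (P [set t | (error <= tau^-1 * sketched_error t)%R] <=
     (expR (- (c * l%:R / 2) * (rho * (tau - 1) ^+ 2)))%:E)%E.
Proof.
case: N W A f Vt => // n W A f Vt dO _ /andP[l0 lN] hW hA comm Wf res0 gV tau1.
move=> c rho V VTf error sketched_error.
have [oO _ _] := dO; have mO := measurable_open oO.
have tau0 : 0 < tau by exact: lt_trans tau1.
pose h z := f z - A f z.
have hL : L2 Omega h.
  by apply: L2_sub => //; [have [WL _ _ _] := hW; exact: WL | exact: hA.1].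
have [u [v [sigma [hs s0 s0E]]]] := svd_leading dO hL res0.
have [uorth _ smono _] := hs.
pose M : R := c * l%:R.
have c0 : 0 < c by rewrite ltr0n; case: (k).
have lR0 : 0 < l%:R :> R by rewrite ltr0n.
have M0 : 0 < M by rewrite mulr_gt0.
pose r (i : 'I_n.+1) := sigma i ^+ 2 / sigma 0 ^+ 2.
have r01 i : 0 <= r i <= 1.
  have /andP[si0 si] := smono 0 i (ltn_ord i).
  rewrite divr_ge0 ?sqr_ge0//= ler_pdivrMr ?exprn_gt0// mul1r.
  by rewrite lerXn2r// nnegrE ltW.
have errE : error ^+ 2 = \sum_(i < n.+1) sigma i ^+ 2 by exact: L2norm_svd hs.
have rhoE : rho = \sum_i r i.
  by rewrite /rho /stable_rank s0E -/error errE mulr_suml.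
have rho0 : 0 < rho.
  rewrite rhoE (bigD1 ord0)//= ltr_pwDl//.
    by rewrite /r divff ?ltr01// gt_eqF// exprn_gt0.
  by apply: sumr_ge0 => i _; have /andP[] := r01 i.
pose S t := \sum_i r i * energy u Vt i t.
(* The two norms as functions of the energies: ||V^T h||^2 below, and ||h||^2 in
   [err2]. *)
have skE t : sketched_error t ^+ 2 = sigma 0 ^+ 2 / M * S t.
  rewrite /sketched_error (sketched_errorE _ mO lN hW hA comm Wf).
  rewrite (svd_norm mO _ hL hs) /S mulr_sumr; apply: eq_bigr => i _.
  rewrite /V linearZ/= -scalemxAl norm2_sqZ -/(energy u Vt i t).
  rewrite exprVn sqr_sqrtr ?(ltW M0)// /r -/M; field.
  by rewrite !gt_eqF.
have sk0 t : 0 <= sketched_error t by exact: sqrtr_ge0.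
have err0 : 0 <= error by exact: sqrtr_ge0.
have err2 : error ^+ 2 = sigma 0 ^+ 2 * rho.
  rewrite errE rhoE mulr_sumr; apply: eq_bigr => i _; rewrite /r; field.
  by rewrite gt_eqF.
have mS : measurable_fun setT S.
  apply: measurable_sum => i; apply: measurable_funM => //.
  exact: (measurable_energy u gV).
split.
  have E1 : [set t | tau * sketched_error t <= error] =
      [set t | S t <= M * rho * tau ^- 2].
    apply/funext => t; apply/propext => /=.
    rewrite -[X in is_true X <-> _](@ler_pXn2r _ 2)// ?nnegrE ?mulr_ge0 ?(ltW tau0)//.
    rewrite exprMn skE err2 -(ler_pM2r (x := M * tau ^- 2 / sigma 0 ^+ 2)); last first.
      by rewrite !divr_gt0 ?mulr_gt0 ?exprn_gt0.
    have -> : tau ^+ 2 * (sigma 0 ^+ 2 / M * S t) * (M * tau ^- 2 / sigma 0 ^+ 2) = S t.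
      by field; rewrite !gt_eqF.
    have -> // : sigma 0 ^+ 2 * rho * (M * tau ^- 2 / sigma 0 ^+ 2) = M * rho * tau ^- 2.
    by field; rewrite !gt_eqF.
  have x0 : 0 < M * rho * tau ^- 2 / 2.
    by rewrite divr_gt0// divr_gt0 ?exprn_gt0// (mulr_gt0 M0 rho0).
  apply: le_trans (energy_lower_tail uorth gV l0 x0).
  apply: le_measure; rewrite ?inE.
  - by rewrite E1; exact: measurable_sublevel.
  - apply: measurable_sublevel; apply: measurable_funM => //.
    exact: (measurable_energy u gV).
  (* Only the leading term of S is kept; its weight is r 0 = 1. *)
  rewrite E1 => t /= St; rewrite ler_pM2r ?invr_gt0//; apply: le_trans St.
  rewrite /S (bigD1 ord0)//= /r divff ?gt_eqF ?exprn_gt0// mul1r lerDl.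
  apply: sumr_ge0 => i _; rewrite mulr_ge0 ?energy_ge0//.
  by have /andP[] := r01 i.
have -> : [set t | error <= tau^-1 * sketched_error t] =
    [set t | M * rho * tau ^+ 2 <= S t].
  apply/funext => t; apply/propext => /=.
  rewrite -[X in is_true X <-> _](@ler_pXn2r _ 2)// ?nnegrE ?mulr_ge0 ?invr_ge0 ?(ltW tau0)//.
  rewrite exprMn skE err2 -(ler_pM2r (x := M * tau ^+ 2 / sigma 0 ^+ 2)); last first.
    by rewrite !divr_gt0 ?mulr_gt0 ?exprn_gt0.
  have -> : tau^-1 ^+ 2 * (sigma 0 ^+ 2 / M * S t) * (M * tau ^+ 2 / sigma 0 ^+ 2) = S t.
    by field; rewrite !gt_eqF.
  have -> // : sigma 0 ^+ 2 * rho * (M * tau ^+ 2 / sigma 0 ^+ 2) = M * rho * tau ^+ 2.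
  by field; rewrite !gt_eqF.
rewrite rhoE; exact: energy_upper_tail.
Qed.
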